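(* Let $A$ be a unital $C^*$-algebra and $\phi\colon A\to A$ a positive unital linear map such that for every $a\in A$ the orbit $(\phi^n(a))_{n\in\mathbb N}$ is relatively compact in norm. Let $C_\phi$ be the multiplicative core of $\phi$ in $A$, and let $E_\phi$ be the norm closure of the linear span of all eigenoperators of $\phi$ with eigenvalue of modulus one, i.e. of all $a\in A$ such that $\phi(a)=\lambda a$ for some $\lambda\in\mathbb C$ with $|\lambda|=1$. Assume there exists a set $\mathcal F$ of $\phi$-invariant states of $A$ which is faithful on the $C^*$-algebra generated by $\phi(A)$. Then: (i) $E_\phi=C_\phi$ is a Jordan subalgebra of $A$. (ii) The restriction $\phi|_{E_\phi}$ is a Jordan automorphism of $E_\phi$. (iii) Let $a\in A$. Then $\rho(a\circ b)=0$ for all $\rho\in\mathcal F$ and all $b\in C_\phi$ if and only if $\lim_{n\to\infty}\|\phi^n(a)\|=0$.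
   Context: Write $a\circ b=\frac12(ab+ba)$ for the Jordan product. A Jordan subalgebra of $A$ is a self-adjoint complex linear subspace closed under $\circ$. A Jordan automorphism of a Jordan subalgebra $B$ is a linear bijection $B\to B$ preserving $\circ$ and the adjoint. The definite set of $\phi$ is $A_\phi=\{a\in A:\phi(a\circ a^* )=\phi(a)\circ\phi(a)^*\}$. Put $A_\Phi=\{a\in A_\phi:\phi^k(a)\in A_\phi\text{ for all }k\in\mathbb N\}$. The multiplicative core of $\phi$ is $C_\phi=\bigcap_{n=0}^\infty\phi^n(A_\Phi)$. A state $\rho$ is $\phi$-invariant if $\rho(\phi(x))=\rho(x)$ for all $x\in A$. A set $\mathcal F$ of states is faithful on a $C^*$-subalgebra $N$ if $x\in N$, $x\ge0$ and $\rho(x)=0$ for all $\rho\in\mathcal F$ imply $x=0$. *)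

(* Defs.v *)
From HB Require Import structures.
From mathcomp Require Import all_boot all_order all_algebra.
From mathcomp Require Import complex.
From mathcomp Require Import all_classical all_reals all_analysis.

Set Implicit Arguments.
Unset Strict Implicit.
Unset Printing Implicit Defensive.

Import Order.TTheory GRing.Theory Num.Theory.
Import numFieldNormedType.Exports.

Local Open Scope classical_set_scope.
Local Open Scope ring_scope.

(* Norms in a normed module over R[i] are R[i]-valued, and the order of R[i] is
   z <= w iff w - z is real and nonnegative; thus `|x| is a nonnegative real.
   Rings are nonzero in MathComp, whence cone_neq0. The product is part of the
   mixin, rather than inherited from GRing.Algebra, because Hierarchy Builder
   rejects a structure below both GRing.Algebra and NormedModule (numDomainType
   is already their join); the ring structure is declared just after. *)
HB.mixin Record isCStarAlgebra (R : realType) A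
    & CompleteNormedModule R[i] A := {
  cone : A;
  cmul : A -> A -> A;
  adj : A -> A;
  cmulA : associative cmul;
  cmul1l : left_id cone cmul;
  cmul1r : right_id cone cmul;
  cmulDl : left_distributive cmul +%R;
  cmulDr : right_distributive cmul +%R;
  cone_neq0 : cone != 0;
  cmulZl : forall (c : R[i]) x y, c *: cmul x y = cmul (c *: x) y;
  cmulZr : forall (c : R[i]) x y, c *: cmul x y = cmul x (c *: y);
  adjD : forall x y, adj (x + y) = adj x + adj y;
  adjZ : forall (c : R[i]) x, adj (c *: x) = Num.conj c *: adj x;
  adj_cmul : forall x y, adj (cmul x y) = cmul (adj y) (adj x);
  adjK : involutive adj;
  norm_cmul_le : forall x y, `|cmul x y| <= `|x| * `|y|;
  norm_adj_cmul : forall x, `|cmul (adj x) x| = `|x| ^+ 2;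
}.

#[short(type="cstarAlgType")]
HB.structure Definition CStarAlgebra (R : realType) :=
  {A of CompleteNormedModule R[i] A & isCStarAlgebra R A}.

HB.instance Definition _ (R : realType) (A : cstarAlgType R) :=
  GRing.Zmodule_isNzRing.Build (CStarAlgebra.sort A)
    (@cmulA R A) (@cmul1l R A) (@cmul1r R A) (@cmulDl R A) (@cmulDr R A)
    (@cone_neq0 R A).

HB.instance Definition _ (R : realType) (A : cstarAlgType R) :=
  GRing.Lmodule_isLalgebra.Build R[i] (CStarAlgebra.sort A) (@cmulZl R A).

HB.instance Definition _ (R : realType) (A : cstarAlgType R) :=
  GRing.Lalgebra_isAlgebra.Build R[i] (CStarAlgebra.sort A) (@cmulZr R A).

Definition jordan (R : realType) (A : cstarAlgType R) (a b : A) : A :=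
  (2^-1 : R[i]) *: (a * b + b * a).

(* x >= 0 in the C*-algebra A. *)
Definition positive (R : realType) (A : cstarAlgType R) (x : A) : Prop :=
  exists b : A, x = adj b * b.

Definition positive_map (R : realType) (A : cstarAlgType R) (f : A -> A) : Prop :=
  forall x : A, positive x -> positive (f x).

(* 0 <= rho x in R[i] says that rho x is real and nonnegative. *)
Definition state (R : realType) (A : cstarAlgType R) (rho : {scalar A}) : Prop :=
  (forall x : A, positive x -> 0 <= rho x) /\ rho 1 = 1.

Definition invariant_state (R : realType) (A : cstarAlgType R)
    (phi : A -> A) (rho : {scalar A}) : Prop :=
  state rho /\ forall x : A, rho (phi x) = rho x.

Definition linear_subspace (R : realType) (A : cstarAlgType R) (B : set A) : Prop :=
  B 0 /\ forall (c : R[i]) (x y : A), B x -> B y -> B (c *: x + y).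

Definition self_adjoint_set (R : realType) (A : cstarAlgType R) (B : set A) : Prop :=
  forall x : A, B x -> B (adj x).

Definition cstar_subalgebra (R : realType) (A : cstarAlgType R) (B : set A) : Prop :=
  [/\ linear_subspace B, (forall x y : A, B x -> B y -> B (x * y)),
      self_adjoint_set B & closed B].

Definition cstar_generated (R : realType) (A : cstarAlgType R) (S : set A) : set A :=
  \bigcap_(B in [set B : set A | cstar_subalgebra B /\ S `<=` B]) B.

Definition faithful_on (R : realType) (A : cstarAlgType R)
    (F : set {scalar A}) (N : set A) : Prop :=
  forall x : A, N x -> positive x -> (forall rho, F rho -> rho x = 0) -> x = 0.

Definition jordan_subalgebra (R : realType) (A : cstarAlgType R) (B : set A) : Prop :=
  [/\ linear_subspace B, self_adjoint_set B &
      forall x y : A, B x -> B y -> B (jordan x y)].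

(* The restriction of f to B is a Jordan automorphism of B; set_bij B B f
   includes f @` B `<=` B. *)
Definition jordan_automorphism_on (R : realType) (A : cstarAlgType R)
    (B : set A) (f : A -> A) : Prop :=
  [/\ set_bij B B f,
      (forall (c : R[i]) (x y : A), B x -> B y -> f (c *: x + y) = c *: f x + f y),
      (forall x y : A, B x -> B y -> f (jordan x y) = jordan (f x) (f y)) &
      (forall x : A, B x -> f (adj x) = adj (f x))].

Definition definite_set (R : realType) (A : cstarAlgType R) (phi : A -> A) : set A :=
  [set a | phi (jordan a (adj a)) = jordan (phi a) (adj (phi a))].

Definition definite_orbit_set (R : realType) (A : cstarAlgType R)
    (phi : A -> A) : set A :=
  [set a | definite_set phi a /\ forall k : nat, definite_set phi (iter k phi a)].

Definition mult_core (R : realType) (A : cstarAlgType R) (phi : A -> A) : set A :=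
  \bigcap_(n in [set: nat]) (iter n phi @` definite_orbit_set phi).

Definition eigenoperators (R : realType) (A : cstarAlgType R) (phi : A -> A) : set A :=
  [set a | exists2 l : R[i], `|l| = 1 & phi a = l *: a].

Definition linear_span (R : realType) (A : cstarAlgType R) (S : set A) : set A :=
  [set x | exists (n : nat) (c : 'I_n -> R[i]) (v : 'I_n -> A),
     (forall i, S (v i)) /\ x = \sum_(i < n) c i *: v i].

Definition eigen_space (R : realType) (A : cstarAlgType R) (phi : A -> A) : set A :=
  closure (linear_span (eigenoperators phi)).

(* precompact S means that closure S is compact (precompactE). *)
Definition precompact_orbits (R : realType) (A : cstarAlgType R)
    (phi : A -> A) : Prop :=
  forall a : A, precompact [set iter n phi a | n in [set: nat]].

(* Main.v *)
Require Import Defs.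
From HB Require Import structures.
From mathcomp Require Import all_boot all_order all_algebra.
From mathcomp Require Import complex.
From mathcomp Require Import all_classical all_reals all_analysis.
From mathcomp Require Import ring lra zify.
From mathcomp Require Import cyclic separable cyclotomic.

Set Implicit Arguments.
Unset Strict Implicit.
Unset Printing Implicit Defensive.

Import Order.TTheory GRing.Theory Num.Theory.
Import numFieldNormedType.Exports.

Local Open Scope classical_set_scope.
Local Open Scope ring_scope.

(** Write E for the closed span of the unimodular eigenoperators, C for the
    multiplicative core, and N for the C*-algebra generated by the range of
    phi.

    For elements a and b put defect a b = phi (a o b^* ) - phi a o (phi b)^*.
    By Kadison's inequality (kadison) the defect is a positive sesquilinear
    form, so defect a a = 0, which says that a is in the definite set, forces
    defect a b = 0 for every b (defect0): the definite set is a closed linear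
    subspace, and phi (a o b) = phi a o phi b as soon as a is definite.  An
    eigenoperator v with unimodular eigenvalue has rho (defect v v) = 0 for
    every invariant state rho, and defect v v is in N, so v is definite by
    faithfulness (eigen_definite).  Hence E consists of definite elements and
    is a Jordan subalgebra on which phi is a Jordan morphism.

    The remaining ingredient is the splitting of each element a as r + s with
    r in E and phi^n s -> 0 (decomposition), of Jacobs-de Leeuw-Glicksberg
    type.  It is proved for any power-bounded operator T with relatively compact
    orbits in a complex Banach space.  Compactness gives a = r + s with s stable and r
    recurrent, that is, T^g r close to r for arbitrarily large g
    (recurrent_stable_decomposition).  For recurrent r, let g be such a return
    time and let B be the set of k < g with T^k r close to r; its density in
    Z/g is bounded below independently of g.  Averaging T^(p+q+s) r over p, q, s
    in B reproduces r approximately; expanded in characters of Z/g, this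
    average is a sum over j of (hat B(j) / |B|)^3 times the j-th Fourier
    coefficient of the orbit, and each such coefficient is almost an
    eigenvector.  By Parseval only boundedly many j matter, so one can pass to
    the limit along an ultrafilter (approximate_eigendecomposition,
    recurrent_eigendecomposition).  The limits exist because the absolutely
    convex hull of a relatively compact orbit is totally bounded.

    If s is stable and b and all its iterates are definite, then
    rho (s o b) = rho (phi^n s o phi^n b) -> 0 (stable_orthogonal); with
    b = s^* and faithfulness on N, a stable element of N whose iterates are
    definite vanishes (stable_definite_eq0).  This shows that the elements of
    E are recurrent, whence phi is bijective on E; that C is contained in E;
    and, applied to a = r + s, the criterion for phi^n a -> 0.

    Kadison's inequality rests on the order structure of a C*-algebra, which is
    developed from the norm axioms alone: an element is b^* b if and only if it
    is the square of a self-adjoint element (sq_adjM), and such elements form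
    a closed proper convex cone. *)

(** * The norm as a real number *)

(** The norm of a module over R[i] takes values in R[i]; [nm] is the same number in R,
    where real arithmetic is available (see [nmE]). *)
Definition nm (R : realType) (V : normedZmodType R[i]) (x : V) : R :=
  complex.Re `|x|.

Lemma nmE (R : realType) (V : normedZmodType R[i]) (x : V) :
  `|x| = (nm x)%:C%C.
Proof.
by have := normr_ge0 x; rewrite /nm; case: `|x| => a b; rewrite lecE /= => /andP[/eqP-> _].
Qed.

Section RealNorm.
Variables (R : realType) (V : normedZmodType R[i]).
Implicit Types x y : V.

Lemma nm_ge0 x : 0 <= nm x.
Proof. by have := normr_ge0 x; rewrite nmE lecR. Qed.

Lemma nm0 : nm (0 : V) = 0.
Proof. by rewrite /nm normr0. Qed.

Lemma nm0_eq0 x : nm x = 0 -> x = 0.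
Proof. by move=> h; apply/normr0_eq0; rewrite nmE h. Qed.

Lemma nmN x : nm (- x) = nm x.
Proof. by rewrite /nm normrN. Qed.

Lemma nmBC x y : nm (x - y) = nm (y - x).
Proof. by rewrite -nmN opprB. Qed.

Lemma nmD x y : nm (x + y) <= nm x + nm y.
Proof. by have := ler_normD x y; rewrite !nmE -rmorphD lecR. Qed.

Lemma nmB x y : nm (x - y) <= nm x + nm y.
Proof. by rewrite -(nmN y) nmD. Qed.

Lemma nm_dist z x y : nm (x - y) <= nm (x - z) + nm (z - y).
Proof. by have := nmD (x - z) (z - y); rewrite addrA subrK. Qed.

Lemma nm1_gt0 x : 0 < nm x + 1.
Proof. by rewrite ltr_wpDl// nm_ge0. Qed.

Lemma nm_sum (I : Type) (s : seq I) (P : pred I) (F : I -> V) :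
  nm (\sum_(i <- s | P i) F i) <= \sum_(i <- s | P i) nm (F i).
Proof.
elim/big_ind2 : _ => [|x a y b h1 h2|//]; first by rewrite nm0.
by rewrite (le_trans (nmD _ _))// lerD.
Qed.

End RealNorm.

Lemma nmC (R : realType) (t : R) : nm (t%:C%C : R[i]) = `|t|.
Proof. by rewrite /nm normc_def /= expr0n /= addr0 sqrtr_sqr. Qed.

Lemma nm_mulc (R : realType) (a b : R[i]) : nm (a * b) = nm a * nm b.
Proof. by apply: complexI; rewrite rmorphM -!nmE normrM. Qed.

Lemma nm_expc (R : realType) (a : R[i]) n : nm (a ^+ n) = nm a ^+ n.
Proof. by apply: complexI; rewrite rmorphXn -!nmE normrX. Qed.

Lemma nm_conj (R : realType) (a : R[i]) : nm (Num.conj a) = nm a.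
Proof. by rewrite /nm norm_conjC. Qed.

Lemma nm1c (R : realType) : nm (1 : R[i]) = 1.
Proof. by rewrite /nm normr1. Qed.

Lemma nm1P (R : realType) (a : R[i]) : `|a| = 1 <-> nm a = 1.
Proof. by split=> [h|h]; [rewrite /nm h | rewrite nmE h]. Qed.

Lemma nmZ (R : realType) (V : normedModType R[i]) (c : R[i]) (x : V) :
  nm (c *: x) = nm c * nm x.
Proof. by apply: complexI; rewrite rmorphM /= -!nmE normrZ. Qed.

Lemma nmZr (R : realType) (V : normedModType R[i]) (t : R) (x : V) :
  0 <= t -> nm (t%:C%C *: x) = t * nm x.
Proof. by move=> t0; rewrite nmZ nmC ger0_norm. Qed.

(** * Topology in terms of the real norm *)

Lemma gt0_complex (R : realType) (e : R[i]) : 0 < e -> exists2 t : R, 0 < t & e = t%:C%C.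
Proof.
by case: e => a b; rewrite ltcE /= => /andP[/eqP-> a0]; exists a.
Qed.

Lemma closure_nm (R : realType) (V : normedModType R[i]) (S : set V) x :
  closure S x <-> forall e : R, 0 < e -> exists2 y, S y & nm (x - y) < e.
Proof.
split=> [cl e e0|h].
  have /cl[y [Sy]] : nbhs x (ball x (e%:C%C : R[i])).
    by apply: nbhsx_ballx; rewrite ltcR.
  by rewrite -ball_normE /= nmE ltcR => xy; exists y.
move=> B /nbhs_ballP[e /= /gt0_complex[t t0 ->]] tB.
have [y Sy xy] := h _ t0; exists y; split=> //; apply: tB.
by rewrite -ball_normE /= nmE ltcR.
Qed.

Lemma cvg_nm (R : realType) (V : normedModType R[i]) (u : nat -> V) (l : V) :
  (u @ \oo --> l) <->
  (forall e : R, 0 < e -> exists N, forall n, (N <= n)%N -> nm (u n - l) < e).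
Proof.
split=> [/cvgrPdist_lt h e e0|h].
  have /h[N _ hN] : 0 < (e%:C%C : R[i]) by rewrite ltcR.
  by exists N => n /hN; rewrite nmBC nmE ltcR.
apply/cvgrPdist_lt => e /gt0_complex[t /h[N hN] ->].
by exists N => // n /hN; rewrite nmE ltcR nmBC.
Qed.

Lemma cauchy_nm (R : realType) (V : completeNormedModType R[i]) (u : nat -> V) :
  (forall e : R, 0 < e -> exists N, forall m n, (N <= m)%N -> (N <= n)%N ->
     nm (u m - u n) < e) -> exists l : V, u @ \oo --> l.
Proof.
move=> h; suff /cvg_ex[l ul] : cvg (u @ \oo) by exists l.
apply: cauchy_cvg; apply/cauchy_ballP => e /gt0_complex[t /h[N hN] ->].
exists ([set x | exists2 n, (N <= n)%N & x = u n], [set x | exists2 n, (N <= n)%N & x = u n]).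
  by split; exists N => // n /= Nn; exists n.
by move=> [_ _] /= [[m Nm ->] [n Nn ->]]; rewrite -ball_normE /= nmE ltcR; apply: hN.
Qed.

Lemma complex_real_lin (R : realType) (z : R[i]) :
  nm z <= `|complex.Re z| + `|complex.Im z|.
Proof.
case: z => a b /=.
have -> : (a +i* b)%C = a%:C%C + 'i%C * b%:C%C by rewrite {1}[LHS]complexE.
rewrite (le_trans (nmD _ _))// nm_mulc !nmC /nm normc_def /= expr0n /= expr1n add0r sqrtr1.
by rewrite mul1r.
Qed.

Lemma iter_linear (K : pzRingType) (V : lmodType K) (T : {linear V -> V}) n c x y :
  iter n T (c *: x + y) = c *: iter n T x + iter n T y.
Proof. by elim: n => //= n ->; rewrite linearP. Qed.

HB.instance Definition _ (K : pzRingType) (V : lmodType K) (T : {linear V -> V}) n :=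
  GRing.isLinear.Build K V V *:%R (iter n T) (iter_linear T n).

(** * Square roots in a C*-algebra *)

Section SquareRoots.
Variables (R : realType) (A : cstarAlgType R).
Implicit Types (x y h k : A) (t : R).

Local Notation "t *r x" := (t%:C%C *: x) (at level 40).

Lemma nm_mul x y : nm (x * y) <= nm x * nm y.
Proof. by have := norm_cmul_le x y; rewrite !nmE -rmorphM lecR. Qed.

Lemma nm_adjM x : nm (adj x * x) = nm x ^+ 2.
Proof. by apply: complexI; rewrite rmorphXn /= -!nmE; exact: norm_adj_cmul. Qed.

Lemma adj_mul x y : adj (x * y) = adj y * adj x.
Proof. exact: adj_cmul. Qed.

Lemma adj0 : adj (0 : A) = 0.
Proof. by rewrite -[X in adj X](scale0r (0 : A)) Defs.adjZ rmorph0 scale0r. Qed.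

Lemma adjN x : adj (- x) = - adj x.
Proof. by rewrite -scaleN1r Defs.adjZ rmorphN rmorph1 scaleN1r. Qed.

Lemma adjB x y : adj (x - y) = adj x - adj y.
Proof. by rewrite adjD adjN. Qed.

Lemma adj1 : adj (1 : A) = 1.
Proof. by rewrite -[RHS]adjK -[adj 1 in RHS]mul1r adj_mul adjK mul1r. Qed.

Lemma adjZr t x : adj (t *r x) = t *r adj x.
Proof. by rewrite Defs.adjZ; congr (_ *: _); apply: CrealP; rewrite complex_real. Qed.

Lemma nm_adj x : nm (adj x) = nm x.
Proof.
suff le y : nm y <= nm (adj y) by apply: le_anti; rewrite le -{2}[x]adjK le.
have [->|y0] := eqVneq (nm y) 0; first exact: nm_ge0.
have := nm_mul (adj y) y; rewrite nm_adjM expr2 ler_pM2r//.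
by rewrite lt_def y0 nm_ge0.
Qed.

Lemma nm1 : nm (1 : A) = 1.
Proof.
have n0 : nm (1 : A) != 0 by apply/eqP => /nm0_eq0/eqP; rewrite oner_eq0.
by apply: (mulfI n0); have := nm_adjM 1; rewrite adj1 !mulr1 -expr2.
Qed.

Lemma nm_exp x n : nm (x ^+ n) <= nm x ^+ n.
Proof.
elim: n => [|n ih]; first by rewrite !expr0 nm1.
by rewrite !exprS (le_trans (nm_mul _ _))// ler_wpM2l// nm_ge0.
Qed.

Lemma nm_sqr h : adj h = h -> nm (h * h) = nm h ^+ 2.
Proof. by move=> sh; rewrite -{1}sh nm_adjM. Qed.

Lemma cvg_mul (u v : nat -> A) x y : u @ \oo --> x -> v @ \oo --> y ->
  (fun n => u n * v n) @ \oo --> x * y.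
Proof.
move=> /cvg_nm ux /cvg_nm vy; apply/cvg_nm => e e0.
pose M := nm x + nm y + 2.
have bound_gt0 : 0 < M by rewrite /M; have := nm_ge0 x; have := nm_ge0 y; lra.
have d0 : 0 < Num.min 1 (e / M) by rewrite lt_min ltr01 divr_gt0.
have [N1 h1] := ux _ d0; have [N2 h2] := vy _ d0.
exists (maxn N1 N2) => n; rewrite geq_max => /andP[/h1 + /h2].
rewrite !lt_min => /andP[a1 a2] /andP[b1 b2].
have -> : u n * v n - x * y = (u n - x) * v n + x * (v n - y).
  by rewrite mulrBl mulrBr addrA subrK.
rewrite (le_lt_trans (nmD _ _))// (le_lt_trans (lerD (nm_mul _ _) (nm_mul _ _)))//.
have vM : nm (v n) <= nm y + 1.
  by rewrite -[v n](subrK y) (le_trans (nmD _ _))// addrC lerD2l ltW.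
have [x0 y0] := (nm_ge0 x, nm_ge0 y).
have : nm (u n - x) * nm (v n) <= (e / M) * (nm y + 1).
  by apply: ler_pM => //; rewrite ?nm_ge0// ltW.
have : nm x * nm (v n - y) <= nm x * (e / M) by rewrite ler_wpM2l// ltW.
have : e = (e / M) * M by rewrite divfK// gt_eqF.
have : 0 < e / M by rewrite divr_gt0.
move: (e / M) => d; rewrite /M; nra.
Qed.

Lemma cvg_adj (u : nat -> A) x : u @ \oo --> x ->
  (fun n => adj (u n)) @ \oo --> adj x.
Proof.
move=> /cvg_nm ux; apply/cvg_nm => e /ux[N h]; exists N => n /h.
by rewrite -adjB nm_adj.
Qed.

Lemma cvg_nm_le (u : nat -> A) x t : u @ \oo --> x ->
  (forall n, nm (u n) <= t) -> nm x <= t.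
Proof.
move=> /cvg_nm ux ut; rewrite leNgt; apply/negP => tx.
have [|N h] := ux (nm x - t); first by rewrite subr_gt0.
have := h N (leqnn _); have := ut N; have := nmD (x - u N) (u N).
by rewrite subrK nmBC; lra.
Qed.

Lemma cvgS_shift (u : nat -> A) x : u @ \oo --> x -> (fun n => u n.+1) @ \oo --> x.
Proof.
move=> /cvg_nm h; apply/cvg_nm => e /h[N hN]; exists N => n Nn.
by apply: hN; rewrite leqW.
Qed.

Lemma cvg_uniq (u : nat -> A) x y : u @ \oo --> x -> u @ \oo --> y -> x = y.
Proof. by apply: cvg_unique. Qed.

(** Iterates of y |-> (u + y^2) / 2 started at 0. A fixed point y gives
    (1 - y)^2 = 1 - u. *)
Fixpoint sqrt_iter (u : A) n : A :=
  if n is m.+1 then 2^-1 *r (u + sqrt_iter u m * sqrt_iter u m) else 0.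

(** The same iteration for the scalar u = 1; it dominates [sqrt_iter u] in norm
    when u is a contraction, including its increments ([sqrt_iter_step]), so
    that it yields convergence even at the boundary nm u = 1. *)
Fixpoint sqrt_maj n : R :=
  if n is m.+1 then 2^-1 * (1 + sqrt_maj m * sqrt_maj m) else 0.

Lemma sqrt_maj_bound n : 0 <= sqrt_maj n <= 1.
Proof. by elim: n => [|n /andP[h1 h2]] /=; [rewrite lexx ler01 | apply/andP; split; nra]. Qed.

Lemma sqrt_maj_le n : sqrt_maj n <= sqrt_maj n.+1.
Proof.
elim: n => [|n ih]; first by have /andP[] := sqrt_maj_bound 1.
have /andP[h1 h2] := sqrt_maj_bound n; have /andP[h3 h4] := sqrt_maj_bound n.+1.
rewrite -[X in _ <= X]/(2^-1 * (1 + sqrt_maj n.+1 * sqrt_maj n.+1)).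
rewrite -[X in X <= _]/(2^-1 * (1 + sqrt_maj n * sqrt_maj n)).
nra.
Qed.

Lemma sqrt_maj_cauchy e : 0 < e ->
  exists N, forall m n, (N <= m)%N -> (N <= n)%N -> sqrt_maj m - sqrt_maj n < e.
Proof.
move=> e0.
have : cvg (sqrt_maj @ \oo).
  apply: nondecreasing_is_cvgn; first by apply/nondecreasing_seqP; exact: sqrt_maj_le.
  by exists 1 => _ [n _ <-]; have /andP[] := sqrt_maj_bound n.
move=> /cvg_ex[l /cvgrPdist_lt h].
have [|N _ hN] := h (e / 2); first by rewrite divr_gt0.
exists N => m n /hN + /hN; rewrite /= !ltr_norml => /andP[] ? ? /andP[] ? ?; lra.
Qed.

Lemma sqrt_iter_comm u x n : GRing.comm x u -> GRing.comm x (sqrt_iter u n).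
Proof.
move=> xu; elim: n => [|n ih] /=; first exact: commr0.
rewrite /GRing.comm -scalerAl -scalerAr; congr (_ *: _).
by apply: commrD => //; apply: commrM.
Qed.

Lemma sqrt_iter_sa u n : adj u = u -> adj (sqrt_iter u n) = sqrt_iter u n.
Proof. by move=> su; elim: n => [|n ih] /=; rewrite ?adj0// adjZr adjD adj_mul su ih. Qed.

Lemma sqrt_iter_le u n : nm u <= 1 -> nm (sqrt_iter u n) <= sqrt_maj n.
Proof.
move=> u1; elim: n => [|n ih] /=; first by rewrite nm0.
rewrite nmZr ?invr_ge0// ler_wpM2l ?invr_ge0// (le_trans (nmD _ _))// lerD//.
by rewrite (le_trans (nm_mul _ _))// ler_pM ?nm_ge0.
Qed.

Lemma sqrt_iter_step u n : nm u <= 1 ->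
  nm (sqrt_iter u n.+1 - sqrt_iter u n) <= sqrt_maj n.+1 - sqrt_maj n.
Proof.
move=> u1; elim: n => [|n ih].
  by rewrite !subr0; exact: sqrt_iter_le.
set a := sqrt_iter u n.+1 in ih *; set b := sqrt_iter u n in ih *.
have -> : sqrt_iter u n.+2 - a = 2^-1 *r ((a - b) * (a + b)).
  rewrite [sqrt_iter u n.+2]/= -/a {2}/a /= -/b -scalerBr.
  congr (_ *: _); have ab : GRing.comm a b.
    by apply: sqrt_iter_comm; apply: commr_sym; apply: sqrt_iter_comm.
  by rewrite opprD addrACA subrr add0r mulrBl !mulrDr ab addrKA.
have la : nm a <= sqrt_maj n.+1 by apply: sqrt_iter_le.
have lb : nm b <= sqrt_maj n by apply: sqrt_iter_le.
rewrite nmZr ?invr_ge0//.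
have : nm ((a - b) * (a + b)) <=
    (sqrt_maj n.+1 - sqrt_maj n) * (sqrt_maj n.+1 + sqrt_maj n).
  rewrite (le_trans (nm_mul _ _))// ler_pM ?nm_ge0// (le_trans (nmD _ _))//.
  exact: lerD.
have E2 : sqrt_maj n.+2 = 2^-1 * (1 + sqrt_maj n.+1 * sqrt_maj n.+1) by [].
have E1 : sqrt_maj n.+1 = 2^-1 * (1 + sqrt_maj n * sqrt_maj n) by [].
by move: (nm _) (sqrt_maj n.+2) (sqrt_maj n.+1) (sqrt_maj n) E2 E1 => N T2 T1 T0; lra.
Qed.

Lemma sqrt_iter_dist u m n : nm u <= 1 -> (n <= m)%N ->
  nm (sqrt_iter u m - sqrt_iter u n) <= sqrt_maj m - sqrt_maj n.
Proof.
move=> u1 /subnKC <-; elim: (m - n)%N => [|d ih]; first by rewrite addn0 !subrr nm0.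
rewrite addnS (le_trans (nm_dist (sqrt_iter u (n + d)) _ _))//.
have := sqrt_iter_step (n + d) u1; move: ih; lra.
Qed.

(** The square root of h lies in the bicommutant of h, as a limit of polynomials
    in h. *)
Lemma sqrt_near1 h : adj h = h -> nm (1 - h) <= 1 ->
  exists k, [/\ adj k = k, k * k = h, nm (1 - k) <= 1 &
                forall z, GRing.comm z h -> GRing.comm z k].
Proof.
move=> sh h1; set u : A := 1 - h in h1.
have su : adj u = u by rewrite /u adjB adj1 sh.
have [y uy] : exists l : A, sqrt_iter u @ \oo --> l.
  apply: cauchy_nm => e /sqrt_maj_cauchy[N hN]; exists N => m n Nm Nn.
  wlog nm_ : m n Nm Nn / (n <= m)%N => [H|].
    by case: (leqP n m) => [|/ltnW] ?; [|rewrite nmBC]; apply: H.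
  by rewrite (le_lt_trans (sqrt_iter_dist h1 nm_))// hN.
have sy : adj y = y.
  have := cvg_adj uy; under eq_fun do rewrite (sqrt_iter_sa _ su).
  by move/cvg_uniq; apply.
have ey : y = 2^-1 *r (u + y * y).
  apply: (cvg_uniq (cvgS_shift uy)); apply: cvgZl_tmp.
  by apply: cvgD; [exact: cvg_cst|exact: cvg_mul].
exists (1 - y); split.
- by rewrite adjB adj1 sy.
- have {ey} : y + y = u + y * y.
    rewrite {1 2}ey -scalerDl -rmorphD.
    by rewrite (_ : 2^-1 + 2^-1 = 1 :> R) ?scale1r//; lra.
  rewrite mulrBl mul1r mulrBr mulr1 => e; rewrite opprB addrA.
  rewrite -[h](subKr 1) -/u (_ : y * y = y + y - u); last by rewrite e addrC addKr.
  by rewrite !addrA subrK addrAC addrK.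
- rewrite subKr; apply: (cvg_nm_le uy) => n.
  by rewrite (le_trans (sqrt_iter_le _ h1))//; have /andP[] := sqrt_maj_bound n.
- move=> z zh; apply: commrB; first exact: commr1.
  have zu : GRing.comm z u by apply: commrB => //; exact: commr1.
  have l1 : (fun n => z * sqrt_iter u n) @ \oo --> z * y.
    by apply: cvg_mul uy; exact: cvg_cst.
  have l2 : (fun n => sqrt_iter u n * z) @ \oo --> y * z.
    by apply: (cvg_mul uy); exact: cvg_cst.
  apply: (cvg_uniq l1); under eq_fun do rewrite (sqrt_iter_comm _ zu).
  exact: l2.
Qed.

(** h + i k is unitary, and h is its real part. *)
Lemma nm_cos h k : adj h = h -> adj k = k -> GRing.comm h k ->
  h * h + k * k = 1 -> nm h <= 1.
Proof.
move=> sh sk hk hk1.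
pose v := h + 'i *: k.
have av : adj v = h - 'i *: k by rewrite adjD Defs.adjZ sh sk conjCi scaleNr.
have vv : adj v * v = 1.
  rewrite av /v mulrBl !mulrDr -!scalerAl -!scalerAr scalerA mulCii scaleN1r.
  by rewrite hk opprB addrACA subrr addr0.
have v1 : nm v = 1.
  by apply/eqP; rewrite -(@eqrXn2 _ 2)// ?nm_ge0// -nm_adjM vv nm1 expr1n.
have : v + adj v = 2%:R%:C%C *: h.
  by rewrite av /v addrACA subrr addr0 -mulr2n rmorph_nat -[LHS]scaler_nat.
move=> /(congr1 (@nm _ _)); rewrite nmZr//.
by have := nmD v (adj v); rewrite nm_adj v1 => + e; rewrite e; lra.
Qed.

(** With k a square root of 1 - h^2, the previous lemma bounds k. *)
Lemma nm_1Bsqr h : adj h = h -> nm h <= 1 -> nm (1 - h * h) <= 1.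
Proof.
move=> sh h1.
have h2 : nm (h * h) <= 1 by rewrite nm_sqr// expr_le1// nm_ge0.
have [||k [sk kk _ ck]] := @sqrt_near1 (1 - h * h).
- by rewrite adjB adj1 adj_mul sh.
- by rewrite subKr.
have hk : GRing.comm h k.
  by apply: ck; apply: commrB; [exact: commr1|apply: commrM].
have : nm k <= 1 by apply: (nm_cos sk sh (commr_sym hk)); rewrite kk subrK.
by rewrite -kk nm_sqr// => k1; rewrite expr_le1// nm_ge0.
Qed.

End SquareRoots.

(** * The cone of squares *)

Section Cone.
Variables (R : realType) (A : cstarAlgType R).
Implicit Types (x y h k p q : A) (t : R).
Local Notation "t *r x" := (t%:C%C *: x) (at level 40).

(** Squares of self-adjoint elements; these are the positive elements by
    [positiveP] below. *)
Definition sq x := exists2 k, adj k = k & x = k * k.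

Lemma sqrtM t : 0 <= t -> Num.sqrt t * Num.sqrt t = t.
Proof. by move=> t0; rewrite -expr2 sqr_sqrtr. Qed.

Lemma rscaleA s t x : s *r (t *r x) = (s * t) *r x.
Proof. by rewrite scalerA rmorphM. Qed.

Lemma rscaleM s t x y : (s *r x) * (t *r y) = (s * t) *r (x * y).
Proof. by rewrite -scalerAl -scalerAr rscaleA. Qed.

Lemma rscale1 x : (1 : R) *r x = x.
Proof. by rewrite rmorph1 scale1r. Qed.

Lemma rscale0 x : (0 : R) *r x = 0.
Proof. by rewrite rmorph0 scale0r. Qed.

Lemma rscaleDl s t x : (s + t) *r x = s *r x + t *r x.
Proof. by rewrite rmorphD scalerDl. Qed.

Lemma sq_sa x : sq x -> adj x = x.
Proof. by move=> [k sk ->]; rewrite adj_mul sk. Qed.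

Lemma sq_scale t x : 0 <= t -> sq x -> sq (t *r x).
Proof.
move=> t0 [k sk ->]; exists (Num.sqrt t *r k); first by rewrite adjZr sk.
by rewrite rscaleM sqrtM.
Qed.

Lemma sqrt_near t h : adj h = h -> 0 < t -> nm (t *r 1 - h) <= t ->
  exists k, [/\ adj k = k, k * k = h, nm (Num.sqrt t *r 1 - k) <= Num.sqrt t &
                forall z, GRing.comm z h -> GRing.comm z k].
Proof.
move=> sh t0 ht; have tn0 : t != 0 by rewrite gt_eqF.
have [||k [sk kk k1 ck]] := @sqrt_near1 _ _ (t^-1 *r h).
- by rewrite adjZr sh.
- have -> : 1 - t^-1 *r h = t^-1 *r (t *r 1 - h).
    by rewrite scalerBr rscaleA mulVf// rscale1.
  by rewrite nmZr ?invr_ge0 ?(ltW t0)// mulrC ler_pdivrMr// mul1r.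
exists (Num.sqrt t *r k); split.
- by rewrite adjZr sk.
- by rewrite rscaleM sqrtM ?(ltW t0)// kk rscaleA mulfV// rscale1.
- by rewrite -scalerBr nmZr ?sqrtr_ge0// ler_piMr// sqrtr_ge0.
- move=> z zh; have zk : GRing.comm z k.
    by apply: ck; rewrite /GRing.comm -scalerAl -scalerAr zh.
  by rewrite /GRing.comm -scalerAl -scalerAr zk.
Qed.

(** With [sq_near], this characterizes squares by a norm inequality, from which
    closure under sums and limits is immediate. *)
Lemma near_sq t k : adj k = k -> 0 < t -> nm (k * k) <= t ->
  nm (t *r 1 - k * k) <= t.
Proof.
move=> sk t0 kt; set s := Num.sqrt t; have s0 : 0 < s by rewrite sqrtr_gt0.
have st : s * s = t by rewrite sqrtM ?ltW.
have := @nm_1Bsqr _ _ (s^-1 *r k); rewrite adjZr sk => /(_ erefl).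
rewrite nmZr ?invr_ge0 ?(ltW s0)// mulrC ler_pdivrMr// mul1r.
have -> : nm k <= s by rewrite -(@ler_pXn2r _ 2)// ?nnegrE ?nm_ge0 ?(ltW s0)// -nm_sqr// expr2 st.
move=> /(_ isT); rewrite rscaleM => le1.
have -> : t *r 1 - k * k = t *r (1 - (s^-1 * s^-1) *r (k * k)).
  rewrite scalerBr rscaleA -invfM st mulfV ?rscale1//; exact: lt0r_neq0.
by rewrite nmZr ?(ltW t0)// ler_piMr ?(ltW t0).
Qed.

Lemma sq_near t h : adj h = h -> 0 < t -> nm (t *r 1 - h) <= t -> sq h.
Proof. by move=> sh t0 /(sqrt_near sh t0)[k [sk <- _ _]]; exists k. Qed.

Lemma sq_nearP t h : 0 < t -> nm h <= t -> sq h -> nm (t *r 1 - h) <= t.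
Proof. by move=> t0 ht [k sk hk]; move: ht; rewrite hk; exact: near_sq. Qed.

Lemma sq_root x : sq x -> exists k, [/\ adj k = k, k * k = x, sq k &
  forall z, GRing.comm z x -> GRing.comm z k].
Proof.
move=> sx; have sax := sq_sa sx; have t0 := nm1_gt0 x.
have /(sqrt_near sax t0)[k [sk kk kn ck]] : nm ((nm x + 1) *r 1 - x) <= nm x + 1.
  by apply: sq_nearP => //; rewrite lerDl.
by exists k; split=> //; apply: sq_near kn => //; rewrite sqrtr_gt0.
Qed.

Lemma sq_add x y : sq x -> sq y -> sq (x + y).
Proof.
move=> sx sy; pose t := nm x + nm y + 1.
have [x0 y0] := (nm_ge0 x, nm_ge0 y).
have t0 : 0 < t by rewrite /t; lra.
apply: (@sq_near (t + t)); first by rewrite adjD !sq_sa.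
  by rewrite addr_gt0.
rewrite rscaleDl opprD addrACA (le_trans (nmD _ _))// lerD//.
  by apply: sq_nearP => //; rewrite /t; lra.
by apply: sq_nearP => //; rewrite /t; lra.
Qed.

Lemma sq_closed (u : nat -> A) x : u @ \oo --> x -> (forall n, sq (u n)) -> sq x.
Proof.
move=> ux su; pose t := nm x + 1.
have t0 : 0 < t := nm1_gt0 x.
apply: (sq_near _ t0).
  apply: (cvg_uniq (cvg_adj ux)).
  by under eq_fun do rewrite (sq_sa (su _)).
apply/ler_addgt0Pr => e e0.
have [N hN] : exists N, forall n, (N <= n)%N -> nm (u n - x) < Num.min 1 e.
  by have /cvg_nm := ux; apply; rewrite lt_min ltr01.
have := hN N (leqnn _); rewrite lt_min => /andP[d1 de].
rewrite (le_trans (nm_dist (u N) _ _))// lerD ?(ltW de)//.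
apply: sq_nearP => //.
by rewrite -[u N](subrK x) (le_trans (nmD _ _))// addrC /t lerD2l ltW.
Qed.

Lemma sq_mul x y : sq x -> sq y -> GRing.comm x y -> sq (x * y).
Proof.
move=> /sq_root[k [sk <- _ ck]] /sq_root[l [sl <- _ cl]] xy.
have kl : GRing.comm k l.
  by apply: cl; apply: commr_sym; apply: ck; apply: commr_sym.
exists (k * l); first by rewrite adj_mul sk sl kl.
by rewrite -!mulrA; congr (_ * _); rewrite !mulrA kl.
Qed.

Lemma rscale_eq0 t x : t != 0 -> t *r x = 0 -> x = 0.
Proof. by move=> t0 /(congr1 (fun z => t^-1 *r z)); rewrite rscaleA mulVf// rscale1 scaler0. Qed.

(** If x = k^2 and - x = l^2 with k and l commuting, then (k + i l)^* (k + i l) = 0. *)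
Lemma sq_anti x : sq x -> sq (- x) -> x = 0.
Proof.
move=> /sq_root[k [sk kx _ ck]] [l sl lx].
have kl : GRing.comm k l.
  apply: commr_sym; apply: ck; rewrite -[x]opprK lx.
  by apply: commrN; apply: commrM.
pose v := k + 'i *: l.
have av : adj v = k - 'i *: l by rewrite adjD Defs.adjZ sk sl conjCi scaleNr.
have v0 : v = 0.
  apply: nm0_eq0; apply/eqP; rewrite -(@eqrXn2 _ 2) ?nm_ge0// -nm_adjM av.
  rewrite /v mulrBl !mulrDr -!scalerAl -!scalerAr scalerA mulCii scaleN1r.
  by rewrite kl opprB addrACA subrr addr0 kx -lx subrr nm0 expr0n.
have k0 : 2%:R *r k = 0.
  by rewrite rmorph_nat scaler_nat mulr2n -[X in X + _](subrK ('i *: l)) -addrA -av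
    [_ + k]addrC -/v v0 adj0 addr0.
by rewrite -kx (rscale_eq0 _ k0) ?mul0r// pnatr_eq0.
Qed.

Lemma sq_nm_le1 x : sq x -> sq (1 - x) -> nm x <= 1.
Proof.
move=> /sq_root[k [sk kx _ ck]] [l sl lx].
have kl : GRing.comm k l.
  apply: commr_sym; apply: ck; rewrite -[x](subKr 1) lx.
  by apply: commrB; [exact: commr1|apply: commrM].
have : nm k <= 1 by apply: (nm_cos sk sl kl); rewrite kx -lx addrC subrK.
by rewrite -kx nm_sqr// => k1; rewrite expr_le1// nm_ge0.
Qed.

(** In the order defined by squares, g (1 + g)^n dominates n g^2. *)
Lemma sq_nm_bounded_pow g : sq g -> (forall n, nm (g * (1 + g) ^+ n) <= 1) -> g = 0.
Proof.
move=> sg gn; pose f n := g * (1 + g) ^+ n.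
have cf n : GRing.comm g (f n).
  by apply: commrM => //; apply: commrX; apply: commrD => //; exact: commr1.
have fS n : f n.+1 = f n + g * f n.
  by rewrite {1}/f exprSr mulrA -/(f n) mulrDr mulr1 cf.
have sf n : sq (f n).
  elim: n => [|n ih]; first by rewrite /f expr0 mulr1.
  by rewrite fS; apply: sq_add => //; apply: sq_mul.
have sfg n : sq (f n - g).
  elim: n => [|n ih].
    rewrite /f expr0 mulr1 subrr -(rscale0 0); apply: sq_scale => //.
    by exists 0; rewrite ?adj0 ?mul0r.
  by rewrite fS addrAC; apply: sq_add => //; apply: sq_mul.
have sgg : sq (g * g) by apply: sq_mul.
have sfgg n : sq (f n - n%:R *r (g * g)).
  elim: n => [|n ih]; first by rewrite rscale0 subr0.
  rewrite fS -addn1 natrD rscaleDl rscale1 opprD addrACA; apply: sq_add => //.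
  by rewrite -mulrBr; apply: sq_mul => //; apply: commrB.
have le1 n : n%:R * nm (g * g) <= 1.
  rewrite -nmZr ?ler0n//; apply: sq_nm_le1; first exact: sq_scale.
  rewrite -[X in sq X](subrKA (f n)); apply: sq_add => //.
  have := sq_nearP ltr01 (gn n) (sf n); rewrite rscale1 => h.
  apply: (sq_near _ ltr01); first by rewrite adjB adj1 sq_sa.
  by rewrite rscale1 subKr; exact: gn.
have g0 : nm (g * g) = 0.
  apply/eqP; rewrite eq_le nm_ge0 andbT leNgt; apply/negP => gg0.
  have := le1 (Num.truncn (nm (g * g))^-1).+1.
  rewrite leNgt => /negP; apply.
  rewrite -ltr_pdivrMr// div1r; exact: truncnS_gt.
by apply: nm0_eq0; apply/eqP; rewrite -sqrf_eq0 -nm_sqr ?g0// sq_sa.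
Qed.

(** From y^2 x = - x z^2 one gets (1 - y^2)^n x = x (1 + z^2)^n; the left side is
    bounded in n, so z^2 (1 + z^2)^n = - x^* (1 - y^2)^n x is bounded too. This replaces
    the comparison of the spectra of x x^* and x^* x. *)
Lemma sylvester_contraction x y z : adj y = y -> adj z = z -> nm x <= 1 ->
  x * adj x = y * y -> adj x * x = - (z * z) -> x = 0.
Proof.
move=> sy sz x1 xy xz.
have y1 : nm (1 - y * y) <= 1.
  apply: nm_1Bsqr => //; rewrite -(@expr_le1 _ 2)// ?nm_ge0// -nm_sqr//.
  by rewrite -xy (le_trans (nm_mul _ _))// nm_adj -expr2 expr_le1// nm_ge0.
have e n : (1 - y * y) ^+ n * x = x * (1 + z * z) ^+ n.
  elim: n => [|n ih]; first by rewrite !expr0 mul1r mulr1.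
  rewrite exprS -mulrA ih [in RHS]exprS !mulrA; congr (_ * _).
  by rewrite mulrBl mul1r -xy -mulrA xz mulrN opprK mulrDr mulr1.
have z0 : z * z = 0.
  apply: sq_nm_bounded_pow; first by exists z.
  move=> n; rewrite -nmN -mulNr -xz -mulrA -e.
  rewrite (le_trans (nm_mul _ _))// nm_adj -[X in _ <= X]mulr1 ler_pM ?nm_ge0//.
  rewrite (le_trans (nm_mul _ _))// -[X in _ <= X]mulr1 ler_pM ?nm_ge0//.
  by rewrite (le_trans (nm_exp _ _))// exprn_ile1// nm_ge0.
apply: nm0_eq0; apply/eqP.
by rewrite -sqrf_eq0 -nm_adjM xz z0 oppr0 nm0.
Qed.

Lemma sylvester_eq0 x y z : adj y = y -> adj z = z ->
  x * adj x = y * y -> adj x * x = - (z * z) -> x = 0.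
Proof.
move=> sy sz xy xz; pose c := (nm x + 1)^-1.
have c0 : 0 < c by rewrite invr_gt0 nm1_gt0.
apply: (@rscale_eq0 c); first by rewrite gt_eqF.
apply: (@sylvester_contraction _ (c *r y) (c *r z));
  rewrite ?adjZr ?sy ?sz// ?rscaleM ?xy ?xz ?scalerN//.
by rewrite nmZr ?(ltW c0)// mulrC ler_pdivrMr ?nm1_gt0// mul1r lerDl.
Qed.

Lemma parallelogram_cross (V : zmodType) (a b c d : V) :
  a + b + (c + d) - (a - b - (c - d)) = b + c + (b + c).
Proof.
rewrite opprD addrACA.
have -> : a + b - (a - b) = b + b by rewrite opprB addrC addrA subrK.
have -> : c + d - - (c - d) = c + c by rewrite opprK addrC [c + d]addrC addrA subrK.
exact: addrACA.
Qed.

(** With x = h + i k, both sides are 4 (h^2 + k^2). *)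
Lemma cartesian_sqr x :
  (x + adj x) * (x + adj x) + ('i *: (x - adj x)) * ('i *: (x - adj x)) =
  2%:R *r (x * adj x + adj x * x).
Proof.
rewrite -scalerAl -scalerAr scalerA mulCii scaleN1r mulrDl.
rewrite [x * (_ + _)]mulrDr [adj x * (_ + _)]mulrDr mulrBl !mulrBr.
by rewrite rmorph_nat scaler_nat mulr2n parallelogram_cross.
Qed.

Lemma sa_cartesian_re x : adj (x + adj x) = x + adj x.
Proof. by rewrite adjD adjK addrC. Qed.

Lemma sa_cartesian_im x : adj ('i *: (x - adj x)) = 'i *: (x - adj x).
Proof. by rewrite Defs.adjZ conjCi adjB adjK scaleNr -scalerN opprB. Qed.

(** Let h = b^* b, a = |h| and n = a - h, twice the negative part of h. Then
    x = b n satisfies x^* x = - n a n, minus a square, while x x^* + x^* x is a square;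
    so x x^* is a square as well, [sylvester_eq0] gives x = 0, and then n = 0, that
    is, h = |h|. *)
Lemma sq_adjM b : sq (adj b * b).
Proof.
set h := adj b * b; have sh : adj h = h by rewrite adj_mul adjK.
have [a [sa ah /sq_root[m [sm ma _ cm]] ca]] : exists a, [/\ adj a = a, a * a = h * h, sq a &
    forall z, GRing.comm z (h * h) -> GRing.comm z a].
  by apply: sq_root; exists h.
have ha : GRing.comm h a by apply: ca; apply: commrM.
have am : GRing.comm a m by apply: cm.
have hm : GRing.comm h m by apply: cm.
pose n := a - h.
have sn : adj n = n by rewrite /n adjB sa sh.
have mn : GRing.comm m n by apply: commrB; apply: commr_sym.
have hn : h * n = - (a * n).
  by rewrite /n !mulrBr ah opprB ha.
pose z := m * n.
have sz : adj z = z by rewrite adj_mul sm sn -mn.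
have nan : n * a * n = z * z.
  by rewrite /z -ma !mulrA -mn.
have xz : adj (b * n) * (b * n) = - (z * z).
  by rewrite adj_mul sn mulrA -[n * _ * _]mulrA -/h -mulrA hn mulrN mulrA nan.
set x := b * n in xz.
have [y sy xy] : sq (x * adj x).
  have e : 2%:R *r (x * adj x) = ((x + adj x) * (x + adj x) +
      ('i *: (x - adj x)) * ('i *: (x - adj x))) + 2%:R *r (z * z).
    by rewrite cartesian_sqr -scalerDr xz addrNK.
  have : sq (2%:R *r (x * adj x)).
    by rewrite e; apply: sq_add; [apply: sq_add|apply: sq_scale => //; exists z] => //;
      [exists (x + adj x); rewrite ?sa_cartesian_re
      |exists ('i *: (x - adj x)); rewrite ?sa_cartesian_im].
  move=> /(@sq_scale 2^-1); rewrite rscaleA mulVf ?pnatr_eq0// rscale1.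
  by apply; rewrite invr_ge0.
have x0 := sylvester_eq0 sy sz xy xz.
have nan0 : n * a * n = 0 by rewrite nan; apply: oppr_inj; rewrite -xz x0 mulr0 oppr0.
(* h n = - a n gives n n = 2 a n. *)
have n3 : n * (n * n) = 0.
  have -> : n * n = a * n + a * n by rewrite {1}/n mulrBl hn opprK.
  by rewrite mulrDr mulrA nan0 addr0.
have nn : n * n = 0.
  apply: nm0_eq0; apply/eqP; rewrite -sqrf_eq0 -nm_sqr ?adj_mul ?sn//.
  by rewrite -mulrA n3 mulr0 nm0.
have n0 : n = 0 by apply: nm0_eq0; apply/eqP; rewrite -sqrf_eq0 -nm_sqr// nn nm0.
by exists m => //; rewrite ma; apply/esym/eqP; rewrite -subr_eq0 -/n n0.
Qed.

End Cone.

(** * Positive elements and states *)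

Section Positivity.
Variables (R : realType) (A : cstarAlgType R).
Implicit Types (x y h k p q : A) (t : R).
Local Notation "t *r x" := (t%:C%C *: x) (at level 40).

Lemma positiveP x : positive x <-> sq x.
Proof.
by split=> [[b ->]|[k sk ->]]; [exact: sq_adjM | exists k; rewrite sk].
Qed.

Lemma pos_sa x : positive x -> adj x = x.
Proof. by move=> /positiveP /sq_sa. Qed.

Lemma pos_add x y : positive x -> positive y -> positive (x + y).
Proof. by move=> /positiveP ? /positiveP ?; apply/positiveP; exact: sq_add. Qed.

Lemma pos_scale t x : 0 <= t -> positive x -> positive (t *r x).
Proof. by move=> t0 /positiveP ?; apply/positiveP; exact: sq_scale. Qed.

Lemma pos_anti x : positive x -> positive (- x) -> x = 0.
Proof. by move=> /positiveP ? /positiveP ?; exact: sq_anti. Qed.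

Lemma pos_mul x y : positive x -> positive y -> GRing.comm x y -> positive (x * y).
Proof. by move=> /positiveP ? /positiveP ? ?; apply/positiveP; exact: sq_mul. Qed.

Lemma pos_closed (u : nat -> A) x :
  u @ \oo --> x -> (forall n, positive (u n)) -> positive x.
Proof.
by move=> ux pu; apply/positiveP/(sq_closed ux) => n; apply/positiveP.
Qed.

Lemma pos_conj x p : adj x = x -> positive p -> positive (x * p * x).
Proof.
by move=> sx [b ->]; exists (b * x); rewrite adj_mul sx !mulrA.
Qed.

Lemma pos_sqr h : adj h = h -> positive (h * h).
Proof. by move=> sh; exists h; rewrite sh. Qed.

Lemma pos1 : positive (1 : A).
Proof. by exists 1; rewrite adj1 mulr1. Qed.

Lemma adj_nat n : adj (n%:R : A) = n%:R.
Proof. by elim: n => [|n ih]; rewrite ?adj0// -natr1 adjD ih adj1. Qed.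

Lemma pos0 : positive (0 : A).
Proof. by exists 0; rewrite mulr0. Qed.

(** y / (n + 1) tends to 0 and the cone is closed. *)
Lemma pos_eps x y : (forall n : nat, positive (x + n.+1%:R^-1 *r y)) -> positive x.
Proof.
apply: pos_closed; apply/cvg_nm => e e0.
exists (Num.truncn (nm y / e)) => n ney; rewrite addrC addrA addNr add0r.
rewrite nmZr ?invr_ge0 ?ler0n// mulrC ltr_pdivrMr ?ltr0n// mulrC -ltr_pdivrMr//.
by rewrite (lt_le_trans (truncnS_gt _))// ler_nat.
Qed.

Lemma pos_bound t h : adj h = h -> nm h <= t -> positive (t *r 1 - h).
Proof.
move=> sh ht; have : 0 <= t by rewrite (le_trans (nm_ge0 h)).
rewrite le_eqVlt => /predU1P[t0|t0].
  have -> : h = 0 by apply: nm0_eq0; apply/eqP; rewrite eq_le nm_ge0 t0 ht.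
  by rewrite -t0 rscale0 subr0; exact: pos0.
apply/positiveP/(sq_near _ t0); first by rewrite adjB adjZr adj1 sh.
by rewrite subKr.
Qed.

Lemma pos_boundD t h : adj h = h -> nm h <= t -> positive (t *r 1 + h).
Proof. by move=> sh ht; rewrite -[h]opprK; apply: pos_bound; rewrite ?adjN ?sh// nmN. Qed.

Lemma nm_pos_le t h : 0 <= t -> positive (t *r 1 - h) -> positive (t *r 1 + h) ->
  nm h <= t.
Proof.
rewrite le_eqVlt => /predU1P[<-|t0].
  by rewrite rscale0 sub0r add0r => ? ?; rewrite (_ : h = 0) ?nm0//; exact: pos_anti.
wlog -> : t t0 h / t = 1 => [H p1 p2|].
  have ti : 0 <= t^-1 by rewrite invr_ge0 ltW.
  have tt : t^-1 *r (t *r (1 : A)) = 1 by rewrite rscaleA mulVf ?rscale1// gt_eqF.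
  have := H 1 ltr01 (t^-1 *r h) erefl; rewrite rscale1 -tt -scalerBr -scalerDr.
  move=> /(_ (pos_scale ti p1) (pos_scale ti p2)).
  by rewrite nmZr// mulrC ler_pdivrMr// mul1r.
rewrite rscale1 => p1 p2.
have sh : adj h = h by apply: (addrI 1); rewrite -{1}adj1 -adjD pos_sa.
have : nm (h * h) <= 1.
  apply: sq_nm_le1; apply/positiveP; first exact: pos_sqr.
  have -> : 1 - h * h = (1 - h) * (1 + h).
    by rewrite mulrDr mulr1 mulrBl mul1r addrA subrK.
  apply: pos_mul => //; apply: commrD; first exact: commr1.
  by apply: commr_sym; apply: commrB => //; exact: commr1.
by rewrite nm_sqr// expr_le1// nm_ge0.
Qed.

Lemma cartesian x : 2%:R *r x = (x + adj x) - 'i *: ('i *: (x - adj x)).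
Proof.
by rewrite scalerA mulCii scaleN1r opprK addrACA subrr addr0 rmorph_nat scaler_nat mulr2n.
Qed.

Lemma nm_i : nm ('i : R[i]) = 1.
Proof. by apply/nm1P; exact: normCi. Qed.

Lemma nm_cartesian_re x : nm (x + adj x) <= 2 * nm x.
Proof. by have := nmD x (adj x); rewrite nm_adj; lra. Qed.

Lemma nm_cartesian_im x : nm ('i *: (x - adj x)) <= 2 * nm x.
Proof. by have := nmB x (adj x); rewrite nm_adj nmZ nm_i; lra. Qed.

(** Decomposition into self-adjoint parts costs a factor 2. *)
Lemma nm_lin_sa (V : normedZmodType R[i]) (f : A -> V) :
  (forall x y, f (x - y) = f x - f y) ->
  (forall c x, nm (f (c *: x)) = nm c * nm (f x)) ->
  (forall h, adj h = h -> nm (f h) <= nm h) -> forall x, nm (f x) <= 2 * nm x.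
Proof.
move=> fB fZ fh x; have := fh _ (sa_cartesian_re x); have := fh _ (sa_cartesian_im x).
have := nmB (f (x + adj x)) (f ('i *: ('i *: (x - adj x)))).
rewrite -fB -cartesian (fZ _ x) (fZ _ ('i *: _)) nmC nm_i mul1r ger0_norm ?ler0n//.
by have := nm_cartesian_re x; have := nm_cartesian_im x; lra.
Qed.

Lemma state_bound (rho : {scalar A}) : state rho -> forall x, nm (rho x) <= 2 * nm x.
Proof.
move=> [pr r1]; apply: nm_lin_sa => [x y|c x|h sh]; first exact: linearB.
  by rewrite linearZ /= nm_mulc.
have e c : rho (c *: 1 + h) = c + rho h by rewrite linearD linearZ /= r1 mulr1.
have e' c : rho (c *: 1 - h) = c - rho h by rewrite linearB linearZ /= r1 mulr1.
have := pr _ (pos_bound sh (lexx _)); have := pr _ (pos_boundD sh (lexx _)).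
rewrite e e'; case: (rho h) => a b; rewrite !lecE /= => /andP[/eqP b0 h1] /andP[_ h2].
have -> : (a +i* b)%C = a%:C%C by congr (_ +i* _)%C; move: b0; rewrite add0r.
by rewrite nmC ler_norml; lra.
Qed.

End Positivity.

(** * Positive unital maps *)

Section PositiveMaps.
Variables (R : realType) (A : cstarAlgType R) (phi : {linear A -> A}).
Hypotheses (phi_pos : positive_map phi) (phi1 : phi 1 = 1).
Implicit Types (x y h k p q : A) (t : R).
Local Notation "t *r x" := (t%:C%C *: x) (at level 40).

Lemma phi_sa h : adj h = h -> adj (phi h) = phi h.
Proof.
move=> sh; have := pos_sa (phi_pos (pos_bound sh (lexx _))).
by rewrite linearB linearZ /= phi1 adjB adjZr adj1 => /addrI /oppr_inj.
Qed.

Lemma adj_cart h k : adj h = h -> adj k = k -> adj (h - 'i *: k) = h + 'i *: k.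
Proof. by move=> sh sk; rewrite adjB Defs.adjZ sh sk conjCi scaleNr opprK. Qed.

Lemma phi_adj x : phi (adj x) = adj (phi x).
Proof.
have two0 : (2%:R : R) != 0 by rewrite pnatr_eq0.
apply/eqP; rewrite -subr_eq0; apply/eqP/(rscale_eq0 two0).
have sre := sa_cartesian_re x; have sim := sa_cartesian_im x.
rewrite scalerBr -adjZr -!linearZ /= -adjZr cartesian.
move: (x + _) ('i *: (x - _)) sre sim => h k sh sk.
have eD : phi (h + 'i *: k) = phi h + 'i *: phi k by rewrite linearD linearZ.
have eB : phi (h - 'i *: k) = phi h - 'i *: phi k by rewrite linearB linearZ.
rewrite adj_cart// eD eB.
by rewrite adj_cart ?phi_sa// subrr.
Qed.

Lemma nm_phi_sa h : adj h = h -> nm (phi h) <= nm h.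
Proof.
move=> sh; apply: nm_pos_le; first exact: nm_ge0.
  have := phi_pos (pos_bound sh (lexx _)); by rewrite linearB linearZ /= phi1.
have := phi_pos (pos_boundD sh (lexx _)); by rewrite linearD linearZ /= phi1.
Qed.

Lemma nm_iter n x : nm (iter n phi x) <= 2 * nm x.
Proof.
apply: nm_lin_sa => [y z|c y|h sh]; [exact: linearB|by rewrite linearZ /= nmZ|].
suff [] : adj (iter n phi h) = iter n phi h /\ nm (iter n phi h) <= nm h by [].
elim: n => //= n [ih1 ih2]; rewrite phi_sa//; split=> //.
by rewrite (le_trans (nm_phi_sa ih1)).
Qed.

Section Bernstein.
Variables (h Y : A).
Hypotheses (h0 : positive h) (h1 : positive (1 - h)) (sY : adj Y = Y).

(** The linear map q |-> phi (q(h)) on polynomials. *)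
Definition poly_phi (q : {poly R[i]}) : A := phi (horner_alg h q).

(** Let b_i(h) = C(n,i) h^i (1 - h)^(n-i) be the Bernstein weights; their first and
    second moments are n h and (n h)^2 + n h (1 - h). This is the resulting closed
    form of sum_i (s + i - Y) phi(q(h) b_i(h)) (s + i - Y). *)
Definition bernstein_form (q : {poly R[i]}) (n s : nat) : A :=
  poly_phi (q * ((s%:R + n%:R * 'X) ^+ 2 + n%:R * 'X * (1 - 'X)))
  - Y * poly_phi (q * (s%:R + n%:R * 'X)) - poly_phi (q * (s%:R + n%:R * 'X)) * Y
  + Y * poly_phi q * Y.

Lemma poly_phiD (p q : {poly R[i]}) : poly_phi (p + q) = poly_phi p + poly_phi q.
Proof. by rewrite /poly_phi !linearD. Qed.

Lemma poly_phi_pos i j : positive (poly_phi ('X ^+ i * (1 - 'X) ^+ j)).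
Proof.
apply: phi_pos; rewrite rmorphM !rmorphXn rmorphB rmorph1 /= horner_algX.
have c1 : GRing.comm (1 - h) h by apply: commr_sym; apply: commrB => //; exact: commr1.
apply: pos_mul.
- elim: i => [|i ih]; first by rewrite expr0; exact: pos1.
  by rewrite exprS; apply: pos_mul => //; apply: commrX.
- elim: j => [|j ih]; first by rewrite expr0; exact: pos1.
  by rewrite exprS; apply: pos_mul => //; apply: commrX.
- by apply: commrX; apply: commr_sym; apply: commrX.
Qed.

(** Pascal's rule: the binomial weights of order n + 1 split into those of order
    n, shifted and multiplied by h, and those of order n multiplied by 1 - h. *)
Lemma bernstein_formS (q : {poly R[i]}) n s :
  bernstein_form q n.+1 s =
  bernstein_form (q * 'X) n s.+1 + bernstein_form (q * (1 - 'X)) n s.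
Proof.
rewrite /bernstein_form.
have -> : q * ((s%:R + n.+1%:R * 'X) ^+ 2 + n.+1%:R * 'X * (1 - 'X)) =
  q * 'X * ((s.+1%:R + n%:R * 'X) ^+ 2 + n%:R * 'X * (1 - 'X)) +
  q * (1 - 'X) * ((s%:R + n%:R * 'X) ^+ 2 + n%:R * 'X * (1 - 'X)).
  by rewrite -!natr1; ring.
have -> : q * (s%:R + n.+1%:R * 'X) =
  q * 'X * (s.+1%:R + n%:R * 'X) + q * (1 - 'X) * (s%:R + n%:R * 'X).
  by rewrite -!natr1; ring.
have {7}-> : q = q * 'X + q * (1 - 'X) by ring.
rewrite !poly_phiD !mulrDr !mulrDl.
have BB (a b c d : A) : a + b - (c + d) = (a - c) + (b - d).
  by rewrite opprD addrACA.
by rewrite (BB (poly_phi _) (poly_phi _)) (BB (poly_phi _ - _) (poly_phi _ - _)) addrACA.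
Qed.

Lemma bernstein_form_pos n s i j : positive (bernstein_form ('X ^+ i * (1 - 'X) ^+ j) n s).
Proof.
elim: n s i j => [|n ih] s i j.
  have -> : bernstein_form ('X ^+ i * (1 - 'X) ^+ j) 0 s =
      (Y - s%:R) * poly_phi ('X ^+ i * (1 - 'X) ^+ j) * (Y - s%:R).
    rewrite /bernstein_form; move: ('X^i * _) => q.
    have poly_phin m : poly_phi (q * m%:R) = poly_phi q *+ m.
      by rewrite mulr_natr /poly_phi !raddfMn.
    rewrite !mul0r !addr0 -natrX !poly_phin mulrBl mulrBr mulr_natl mulr_natr.
    rewrite !mulrBl mulrnBl opprB addrC [RHS]addrC -mulrnA mulrnAr mulnn.
    by rewrite addrC [RHS]addrA addrAC.
  by apply: pos_conj; [rewrite adjB sY adj_nat|exact: poly_phi_pos].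
rewrite bernstein_formS -mulrA [_ * 'X]mulrC mulrA -exprSr -mulrA -exprSr; exact: pos_add.
Qed.

End Bernstein.

End PositiveMaps.

(** * Kadison's inequality and the multiplicative defect *)

Section Kadison.
Variables (R : realType) (A : cstarAlgType R) (phi : {linear A -> A}).
Hypotheses (phi_pos : positive_map phi) (phi1 : phi 1 = 1).
Implicit Types (x y h k a b : A) (t : R).
Local Notation "t *r x" := (t%:C%C *: x) (at level 40).

Lemma rscale_nat n x : n%:R *r x = x *+ n.
Proof. by rewrite rmorph_nat scaler_nat. Qed.

(** Positivity of the Bernstein form of order m with Y = m phi(h), divided by m^2, is
    the inequality up to phi(h (1 - h)) / m. *)
Lemma kadison01 h : positive h -> positive (1 - h) ->
  positive (phi (h * h) - phi h * phi h).
Proof.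
move=> h0 h1; apply: (@pos_eps _ _ _ (phi (h * (1 - h)))) => n.
set m := n.+1; set K := phi h.
have sY : adj (K *+ m) = K *+ m.
  by rewrite -rscale_nat adjZr (phi_sa phi_pos phi1)// pos_sa.
have := bernstein_form_pos phi_pos h0 h1 sY m 0 0 0.
have -> : bernstein_form phi h (K *+ m) ('X ^+ 0 * (1 - 'X) ^+ 0) m 0 =
    (phi (h * h) - K * K) *+ (m * m) + phi (h * (1 - h)) *+ m.
  rewrite /bernstein_form !expr0 !mul1r add0r.
  have -> : poly_phi phi h 1 = 1 by rewrite /poly_phi rmorph1.
  have -> : poly_phi phi h (m%:R * 'X) = K *+ m.
    by rewrite /poly_phi mulr_natl !raddfMn /= horner_algX.
  have -> : poly_phi phi h ((m%:R * 'X) ^+ 2 + m%:R * 'X * (1 - 'X)) =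
      phi (h * h) *+ (m * m) + phi (h * (1 - h)) *+ m.
    rewrite /poly_phi !mulr_natl exprMn_n mulrnAl !raddfD !raddfMn /=.
    by rewrite rmorphXn rmorphM rmorphB rmorph1 /= !horner_algX -mulnn expr2.
  rewrite mulr1 subrK mulrnBl addrAC; congr (_ - _ + _).
  by rewrite mulrnAr mulrnAl -mulrnA.
have m0 : (m%:R : R) != 0 by rewrite pnatr_eq0.
move=> /(@pos_scale _ _ (m%:R^-1 * m%:R^-1)) p.
have -> : phi (h * h) - K * K + m%:R^-1 *r phi (h * (1 - h)) =
   (m%:R^-1 * m%:R^-1) *r ((phi (h * h) - K * K) *+ (m * m) + phi (h * (1 - h)) *+ m).
  rewrite -!rscale_nat scalerDr !rscaleA; congr (_ + _).
    by rewrite natrM mulrACA mulVf// mulr1 rscale1.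
  by rewrite -mulrA mulVf// mulr1.
by apply: p; rewrite mulr_ge0// invr_ge0 ler0n.
Qed.

(** The self-adjoint case of [defect] below; it is invariant under real shifts and
    homogeneous, which reduces [kadison] to elements between 0 and 1. *)
Definition square_defect h := phi (h * h) - phi h * phi h.

Lemma square_defect_shift t h : square_defect (t *r 1 + h) = square_defect h.
Proof.
rewrite /square_defect linearD linearZ /= phi1 !mulrDl !mulrDr -!scalerAl -!scalerAr !mul1r !mulr1.
have -> : phi (t *r (t *r 1) + t *r h + (t *r h + h * h)) =
    t *r (t *r 1) + t *r phi h + (t *r phi h + phi (h * h)).
  by rewrite !linearD !linearZ /= phi1.
by rewrite opprD addrACA subrr add0r opprD addrACA subrr add0r.
Qed.

Lemma square_defect_scale t h : square_defect (t *r h) = (t * t) *r square_defect h.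
Proof. by rewrite /square_defect linearZ /= !rscaleM linearZ -scalerBr. Qed.

Lemma kadison h : adj h = h -> positive (phi (h * h) - phi h * phi h).
Proof.
move=> sh; pose t := nm h + 1; have t0 : 0 < t := nm1_gt0 h.
have ht : nm h <= t by rewrite lerDl.
pose k := (2 * t)^-1 *r (t *r 1 + h).
have tt0 : 0 <= (2 * t)^-1 by rewrite invr_ge0 mulr_ge0// ltW.
have k0 : positive k by apply: pos_scale => //; exact: pos_boundD.
have k1 : positive (1 - k).
  have -> : 1 - k = (2 * t)^-1 *r (t *r 1 - h).
    have e1 : (1 : A) = (2 * t)^-1 *r ((2 * t) *r 1).
      by rewrite rscaleA mulVf ?rscale1// mulf_neq0 ?gt_eqF.
    rewrite {1}e1 /k -scalerBr; congr (_ *: _).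
    by rewrite mulr_natl mulr2n rscaleDl opprD addrACA subrr add0r.
  by apply: pos_scale => //; exact: pos_bound.
have := kadison01 k0 k1; rewrite -[X in positive X]/(square_defect k).
rewrite square_defect_scale square_defect_shift.
have c0 : 2 * t != 0 by rewrite mulf_neq0 ?gt_eqF.
move=> /(@pos_scale _ _ ((2 * t) * (2 * t))); rewrite rscaleA.
move: (2 * t) c0 => c c0; rewrite mulrACA mulfV// mulr1 rscale1; apply.
by rewrite -expr2 sqr_ge0.
Qed.

Lemma jordanC a b : jordan a b = jordan b a.
Proof. by rewrite /jordan addrC. Qed.

Lemma jordanDl a b c : jordan (a + b) c = jordan a c + jordan b c.
Proof. by rewrite /jordan -scalerDr mulrDl mulrDr addrACA. Qed.

Lemma jordanZl (c : R[i]) a b : jordan (c *: a) b = c *: jordan a b.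
Proof. by rewrite /jordan -scalerAl -scalerAr -scalerDr !scalerA mulrC. Qed.

Lemma jordanDr a b c : jordan a (b + c) = jordan a b + jordan a c.
Proof. by rewrite jordanC jordanDl ![jordan _ a]jordanC. Qed.

Lemma jordanZr (c : R[i]) a b : jordan a (c *: b) = c *: jordan a b.
Proof. by rewrite jordanC jordanZl jordanC. Qed.

Lemma nm_jordan a b : nm (jordan a b) <= nm a * nm b.
Proof.
rewrite /jordan nmZ.
have -> : nm (2^-1 : R[i]) = 2^-1.
  by rewrite -[2]/(2%:R) -(rmorph_nat (real_complex R)) -fmorphV nmC ger0_norm// invr_ge0.
have := nmD (a * b) (b * a); have := nm_mul a b; have := nm_mul b a; lra.
Qed.

Lemma jordan_cartesian a :
  4%:R *r jordan a (adj a) = (a + adj a) * (a + adj a) + ('i *: (a - adj a)) * ('i *: (a - adj a)).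
Proof.
rewrite cartesian_sqr /jordan.
have -> : 4%:R = 2%:R * 2%:R :> R by rewrite -natrM.
rewrite -rscaleA; congr (_ *: _).
by rewrite scalerA rmorph_nat mulfV ?scale1r// pnatr_eq0.
Qed.

Lemma pos_jordan a : positive (jordan a (adj a)).
Proof.
suff : positive (4%:R *r jordan a (adj a)).
  move=> /(@pos_scale _ _ 4%:R^-1); rewrite rscaleA mulVf ?pnatr_eq0// rscale1.
  by apply; rewrite invr_ge0.
rewrite jordan_cartesian; apply: pos_add; apply: pos_sqr.
  exact: sa_cartesian_re.
exact: sa_cartesian_im.
Qed.

Lemma jordan_eq0 a : jordan a (adj a) = 0 -> a = 0.
Proof.
move=> /(congr1 (fun x => 2%:R *: x)); rewrite scaler0 scalerA mulfV ?pnatr_eq0// scale1r.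
move=> /eqP; rewrite addrC addr_eq0 => /eqP e.
have : adj a * a = 0.
  apply: pos_anti; first by exists a.
  by rewrite e opprK; exists (adj a); rewrite adjK.
by move=> /(congr1 (@nm _ _)); rewrite nm_adjM nm0 => /eqP; rewrite sqrf_eq0 => /eqP /nm0_eq0.
Qed.

(** The sesquilinear form whose vanishing on the diagonal defines the definite
    set. *)
Definition defect a b := phi (jordan a (adj b)) - jordan (phi a) (adj (phi b)).

Lemma defectDl a b c : defect (a + b) c = defect a c + defect b c.
Proof. by rewrite /defect linearD !jordanDl linearD opprD addrACA. Qed.

Lemma defectDr a b c : defect a (b + c) = defect a b + defect a c.
Proof. by rewrite /defect linearD !adjD !jordanDr linearD opprD addrACA. Qed.

Lemma defectZl (c : R[i]) a b : defect (c *: a) b = c *: defect a b.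
Proof.
have eZ x : phi (c *: x) = c *: phi x by rewrite linearZ.
by rewrite /defect eZ !jordanZl eZ -scalerBr.
Qed.

Lemma defectZr (c : R[i]) a b : defect a (c *: b) = Num.conj c *: defect a b.
Proof.
have eZ d x : phi (d *: x) = d *: phi x by rewrite linearZ.
by rewrite /defect (eZ c) !Defs.adjZ !jordanZr (eZ (Num.conj c)) -scalerBr.
Qed.

(** For a = h + i k this is the sum of the square defects of h and k. *)
Lemma defect_pos a : positive (defect a a).
Proof.
suff : positive (4%:R *r defect a a).
  move=> /(@pos_scale _ _ 4%:R^-1); rewrite rscaleA mulVf ?pnatr_eq0// rscale1.
  by apply; rewrite invr_ge0.
have eZ (c : R[i]) x : phi (c *: x) = c *: phi x by rewrite linearZ.
rewrite scalerBr -eZ !jordan_cartesian linearD.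
rewrite -(phi_adj phi_pos phi1).
have -> : phi a + phi (adj a) = phi (a + adj a) by rewrite linearD.
have -> : 'i *: (phi a - phi (adj a)) = phi ('i *: (a - adj a)).
  by rewrite eZ; congr (_ *: _); rewrite linearB.
rewrite opprD addrACA; apply: pos_add; apply: kadison.
  exact: sa_cartesian_re.
exact: sa_cartesian_im.
Qed.

Lemma definite_defect a : definite_set phi a <-> defect a a = 0.
Proof.
rewrite /definite_set /defect /=; split=> [->|/eqP]; first by rewrite subrr.
by rewrite subr_eq0 => /eqP.
Qed.

(** Positivity of the form at a + t b for small real t of both signs. *)
Lemma defect0_sym a b : defect a a = 0 -> defect a b + defect b a = 0.
Proof.
move=> da.
have expand (t : R) : defect (a + t *r b) (a + t *r b) =
    t *r (defect a b + defect b a + t *r defect b b).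
  rewrite defectDl !defectDr !defectZl !defectZr da add0r.
  have -> : Num.conj t%:C%C = t%:C%C by apply: CrealP; rewrite complex_real.
  by rewrite !scalerDr addrA.
have p1 : positive (defect a b + defect b a).
  apply: (@pos_eps _ _ _ (defect b b)) => n; have m0 : (n.+1%:R : R) != 0 by rewrite pnatr_eq0.
  have := defect_pos (a + n.+1%:R^-1 *r b); rewrite expand.
  move=> /(@pos_scale _ _ n.+1%:R); rewrite rscaleA mulfV// rscale1; apply.
  by rewrite ler0n.
have p2 : positive (- (defect a b + defect b a)).
  apply: (@pos_eps _ _ _ (defect b b)) => n; have m0 : (n.+1%:R : R) != 0 by rewrite pnatr_eq0.
  have := defect_pos (a + (- n.+1%:R^-1) *r b); rewrite expand.
  move=> /(@pos_scale _ _ n.+1%:R); rewrite rscaleA mulrN mulfV//.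
  rewrite rmorphN rmorph1 scaleN1r opprD rmorphN scaleNr opprK; apply.
  by rewrite ler0n.
exact: pos_anti.
Qed.

(** [defect0_sym] for b and for i b. *)
Lemma defect0 a b : defect a a = 0 -> defect a b = 0.
Proof.
move=> da; have := defect0_sym b da; have := defect0_sym ('i *: b) da.
rewrite defectZl defectZr conjCi scaleNr addrC -scalerBr => h1.
have i0 : 'i != 0 :> R[i] by exact: neq0Ci.
have h : defect b a - defect a b = 0.
  by have := congr1 (fun x => 'i^-1 *: x) h1; rewrite /= scalerA mulVf// scale1r scaler0.
move/eqP; rewrite -[X in X + _]opprK addrC subr_eq0 => /eqP h2.
move: h; rewrite h2 -opprD => /eqP; rewrite oppr_eq0 -mulr2n -scaler_nat scaler_eq0 pnatr_eq0 /=.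
by move/eqP.
Qed.

Lemma definite_jordan a b : definite_set phi a -> phi (jordan a b) = jordan (phi a) (phi b).
Proof.
move=> /definite_defect /(defect0 (adj b)) /eqP.
by rewrite /defect adjK (phi_adj phi_pos phi1) adjK subr_eq0 => /eqP.
Qed.

Lemma definite_linear (c : R[i]) a b : definite_set phi a -> definite_set phi b ->
  definite_set phi (c *: a + b).
Proof.
move=> /definite_defect da /definite_defect db; apply/definite_defect.
by rewrite defectDl defectZl (defect0 _ da) (defect0 _ db) scaler0 addr0.
Qed.

End Kadison.

(** * Limits along ultrafilters and compactness *)

Section UltraLimits.
Variables (R : realType) (U : set_system nat).
Hypotheses (UU : UltraFilter U).

(** Convergence of a sequence along the ultrafilter U, in terms of the real norm;
    equivalent to filter convergence by [ulimP]. *)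
Definition ulim (V : normedModType R[i]) (u : nat -> V) (l : V) :=
  forall e : R, 0 < e -> U [set n | nm (u n - l) < e].

Lemma ultraE (P : set nat) : ~ U (~` P) -> U P.
Proof. by case: (in_ultra_setVsetC P UU). Qed.

Lemma ulim_compact (T : topologicalType) (K : set T) (u : nat -> T) :
  compact K -> (forall n, K (u n)) -> exists2 l, K l & u @ U --> l.
Proof.
move=> cK uK; have [l [Kl cl]] : K `&` cluster (u @ U) !=set0.
  apply: cK; apply: (@filterS _ U _ setT); last exact: filterT.
  by move=> n _; exact: uK.
exists l => // B Bl; apply: ultraE => nB.
by have [x [? Bx]] := cl (~` B) B nB Bl.
Qed.

Lemma ulimP (V : normedModType R[i]) (u : nat -> V) (l : V) :
  u @ U --> l <-> ulim u l.
Proof.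
split=> [ul e e0|ul B /nbhs_ballP[e /= /gt0_complex[t t0 ->]] tB].
  have : nbhs l (ball l (e%:C%C : R[i])) by apply: nbhsx_ballx; rewrite ltcR.
  by move=> /ul; apply: (@filterS _ U) => n /=; rewrite -ball_normE /= nmE ltcR nmBC.
have := ul _ t0; apply: (@filterS _ U) => n /= un; apply: tB.
by rewrite -ball_normE /= nmE ltcR nmBC.
Qed.

Lemma ulim_cst (V : normedModType R[i]) (l : V) : ulim (fun=> l) l.
Proof.
move=> e e0; apply: (@filterS _ U _ setT); last exact: filterT.
by move=> n _ /=; rewrite subrr nm0.
Qed.

Lemma ulimD (V : normedModType R[i]) (u v : nat -> V) a b :
  ulim u a -> ulim v b -> ulim (fun n => u n + v n) (a + b).
Proof. by move=> /ulimP ua /ulimP vb; apply/ulimP; exact: cvgD. Qed.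

Lemma ulimB (V : normedModType R[i]) (u v : nat -> V) a b :
  ulim u a -> ulim v b -> ulim (fun n => u n - v n) (a - b).
Proof. by move=> /ulimP ua /ulimP vb; apply/ulimP; exact: cvgB. Qed.

Lemma ulimZ (V : normedModType R[i]) (c : nat -> R[i]) (v : nat -> V) a b :
  (c @ U --> (a : R[i]^o)) -> ulim v b -> ulim (fun n => c n *: v n) (a *: b).
Proof. by move=> ca /ulimP vb; apply/ulimP; exact: cvgZ. Qed.

Lemma ulim_sum (V : normedModType R[i]) m (u : 'I_m -> nat -> V) (l : 'I_m -> V) :
  (forall i, ulim (u i) (l i)) -> ulim (fun n => \sum_(i < m) u i n) (\sum_(i < m) l i).
Proof.
elim: m u l => [|m ih] u l ul.
  rewrite big_ord0 (_ : (fun n => _) = fun=> 0); first exact: ulim_cst.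
  by apply/funext => n; rewrite big_ord0.
rewrite big_ord_recr /= (_ : (fun n => _) =
    fun n => \sum_(i < m) u (widen_ord (leqnSn m) i) n + u ord_max n).
  by apply: ulimD => //; apply: ih.
by apply/funext => n; rewrite big_ord_recr.
Qed.

Lemma ulim_le (V : normedModType R[i]) (u : nat -> V) l (b : R) :
  ulim u l -> (forall e, 0 < e -> U [set n | nm (u n) <= b + e]) -> nm l <= b.
Proof.
move=> ul ub; apply/ler_addgt0Pr => e e0; have e2 : 0 < e / 2 by rewrite divr_gt0.
have [n [/= h1 h2]] := filter_ex (filterI (ul _ e2) (ub _ e2)).
have := nmD (l - u n) (u n); rewrite subrK nmBC; lra.
Qed.

Lemma ulim_bounded_complex (c : nat -> R[i]) (b : R) :
  (forall n, nm (c n) <= b) -> exists l : R[i], ulim (c : nat -> R[i]^o) l.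
Proof.
move=> cb.
have seg (z : R[i]) : nm z <= b -> `[- b, b]%classic (complex.Re z) /\
    `[- b, b]%classic (complex.Im z).
  move=> zb; rewrite /= !in_itv /= -!ler_norml; split.
    by rewrite (le_trans _ zb)// -lecR -nmE normc_ge_Re.
  rewrite (le_trans _ zb)// /nm normc_def /= -sqrtr_sqr ler_wsqrtr// lerDr sqr_ge0//.
have [x _ cx] := ulim_compact (@segment_compact R (- b) b) (fun n => (seg _ (cb n)).1).
have [y _ cy] := ulim_compact (@segment_compact R (- b) b) (fun n => (seg _ (cb n)).2).
exists (x +i* y)%C => e e0; have e2 : 0 < e / 2 by rewrite divr_gt0.
have hx : U [set n | `|x - complex.Re (c n)| < e / 2].
  by have /cvgrPdist_lt := cx; apply.
have hy : U [set n | `|y - complex.Im (c n)| < e / 2].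
  by have /cvgrPdist_lt := cy; apply.
have : U ([set n | `|x - complex.Re (c n)| < e / 2] `&` [set n | `|y - complex.Im (c n)| < e / 2]).
  by apply: filterI.
apply: (@filterS _ U) => n [/= h1 h2].
rewrite (le_lt_trans (complex_real_lin _))//.
by move: h1 h2; case: (c n) => a1 a2 /=; rewrite distrC [`|y - _|]distrC; lra.
Qed.

(** For convergence along U in a complete space it suffices that, at each scale,
    U-almost all terms are close to some point. *)
Lemma ulim_cauchy (V : completeNormedModType R[i]) (u : nat -> V) :
  (forall e : R, 0 < e -> exists z, U [set n | nm (u n - z) < e]) -> exists l : V, ulim u l.
Proof.
move=> h; suff /cvg_ex[l ul] : cvg (u @ U) by exists l; apply/ulimP.
apply: cauchy_cvg; apply/cauchy_exP => e /gt0_complex[t /h[z hz] ->]; exists z.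
by move: hz; apply: (@filterS _ U) => n /=; rewrite -ball_normE /= nmE ltcR nmBC.
Qed.

End UltraLimits.

Lemma free_ultra : exists2 U : set_system nat, UltraFilter U & forall N, U [set n | (N <= n)%N].
Proof.
have [U [UU sU]] := @ultraFilterLemma nat \oo _.
by exists U => // N; apply: sU; exists N.
Qed.

Lemma precompact_net (R : realType) (V : normedModType R[i]) (S : set V) (e : R) :
  precompact S -> 0 < e -> exists (K : nat) (s : 'I_K -> V),
    forall x, S x -> exists i, nm (x - s i) < e.
Proof.
rewrite precompactE compact_cover => cS e0.
have e0' : 0 < (e%:C%C : R[i]) by rewrite ltcR.
have [||D _ Dcov] := cS V setT (fun z => ball z (e%:C%C : R[i])).
- by move=> z _; exact: ball_open.
- by move=> x _; exists x => //; exact: ballxx.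
pose D' : seq V := finmap.enum_fset D.
exists (size D'), (fun i => nth 0 D' i) => x /subset_closure/Dcov[z /= zD].
rewrite -ball_normE /= nmE ltcR nmBC => xz.
have zi : (index z D' < size D')%N by rewrite index_mem.
by exists (Ordinal zi); rewrite nth_index.
Qed.

Lemma prim_root_complex (R : realType) n :
  (0 < n)%N -> exists z : R[i], n.-primitive_root z.
Proof.
move=> n0; have [r] := closed_field_poly_normal ('X^n - 1 : {poly R[i]}).
rewrite (monicP (monicXnsubC _ n0)) scale1r => Dr.
suff /hasP[z _ zn] : has n.-primitive_root r by exists z.
apply: has_prim_root => //.
- by apply/allP => z; rewrite -root_prod_XsubC -Dr.
- by rewrite -separable_prod_XsubC -Dr separable_Xn_sub_1// pnatr_eq0 -lt0n.
- by rewrite -ltnS -(size_prod_XsubC r id) -Dr size_XnsubC.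
Qed.

(** * Fourier analysis of an orbit segment *)

Section FiniteFourier.
Variables (R : realType) (V : normedModType R[i]) (T : {linear V -> V}) (r : V).
Variables (g : nat) (w : R[i]).
Hypotheses (g0 : (0 < g)%N) (wg : g.-primitive_root w).

(** The j-th Fourier coefficient of k |-> T^k r on Z/g, with respect to the
    characters k |-> w^(j k). *)
Definition orbit_fourier (j : nat) : V :=
  g%:R^-1 *: \sum_(k < g) (w^-1 ^+ (j * k)) *: iter k T r.

Lemma period_neq0 : (g%:R : R[i]) != 0.
Proof. by rewrite pnatr_eq0 -lt0n. Qed.

Lemma w_neq0 : w != 0.
Proof.
have := prim_expr_order wg; case: eqVneq => // ->.
by rewrite expr0n gtn_eqF// => /esym/eqP; rewrite oner_eq0.
Qed.

Lemma nm_w : nm w = 1.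
Proof.
apply/eqP; rewrite -(@pexpr_eq1 _ _ g)// ?nm_ge0// -nm_expc (prim_expr_order wg).
by rewrite nm1c.
Qed.

Lemma conj_w : Num.conj w = w^-1.
Proof.
by apply: (mulfI w_neq0); rewrite -normCK (iffRL (nm1P w) nm_w) expr1n mulfV// w_neq0.
Qed.

Lemma nm_wV : nm w^-1 = 1.
Proof. by rewrite -conj_w nm_conj nm_w. Qed.

Lemma orthogonality m k :
  \sum_(j < g) w ^+ (j * m) * w^-1 ^+ (j * k) =
  if m == k %[mod g] then g%:R else 0 :> R[i].
Proof.
pose z := w ^+ m * w^-1 ^+ k.
have -> : \sum_(j < g) w ^+ (j * m) * w^-1 ^+ (j * k) = \sum_(j < g) z ^+ j.
  by apply: eq_bigr => j _; rewrite exprMn -!exprM ![(j * _)%N]mulnC.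
have z1 : (z == 1) = (m == k %[mod g]).
  rewrite -(eq_prim_root_expr wg) /z exprVn.
  apply/eqP/eqP => [|->]; last by rewrite mulfV// expf_neq0 ?w_neq0.
  by move=> /(congr1 ( *%R^~ (w ^+ k))); rewrite mulfVK ?expf_neq0 ?w_neq0// mul1r.
rewrite -z1; have [->|zn1] := eqVneq.
  by under eq_bigr do rewrite expr1n; rewrite sumr_const card_ord.
apply: (@mulfI _ (z - 1)); first by rewrite subr_eq0.
rewrite -subrX1 mulr0 /z exprMn -!exprM ![(_ * g)%N]mulnC !exprM.
by rewrite exprVn (prim_expr_order wg) invr1 !expr1n mulr1 subrr.
Qed.

Lemma fourier_inversion m :
  \sum_(j < g) w ^+ (j * m) *: orbit_fourier j = iter (m %% g) T r.
Proof.
have -> : \sum_(j < g) w ^+ (j * m) *: orbit_fourier j =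
    \sum_(k < g) (if m == k %[mod g] then 1 else 0 : R[i]) *: iter k T r.
  under eq_bigr do rewrite /orbit_fourier scalerA scaler_sumr.
  rewrite exchange_big; apply: eq_bigr => k _ /=.
  under eq_bigr do rewrite scalerA mulrAC.
  rewrite -scaler_suml -mulr_suml orthogonality; congr (_ *: _).
  by case: ifP => _; rewrite ?mulfV ?period_neq0// mul0r.
rewrite (bigD1 (Ordinal (ltn_pmod m g0)))//= modn_mod eqxx scale1r big1 ?addr0// => k km.
case: ifPn => [/eqP mk|]; last by rewrite scale0r.
by case/eqP: km; apply: val_inj; rewrite /= mk modn_small.
Qed.

Variable B : {set 'I_g}.

(** Fourier transform of the indicator function of B. *)
Definition fset_hat (j : nat) : R[i] := \sum_(p in B) w ^+ (j * p).

(** The cube of the Fourier transform corresponds to the threefold convolution of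
    the indicator function of B. A third power is what makes the coefficients of
    small modulus negligible in [small_part]. *)
Lemma fset_hat_cube :
  \sum_(j < g) fset_hat j ^+ 3 *: orbit_fourier j =
  \sum_(p in B) \sum_(q in B) \sum_(s in B) iter ((p + q + s) %% g) T r.
Proof.
transitivity (\sum_(j < g) \sum_(p in B) \sum_(q in B) \sum_(s in B)
    w ^+ (j * (p + q + s)) *: orbit_fourier j).
  apply: eq_bigr => j _.
  have F2 : fset_hat j * fset_hat j = \sum_(q in B) \sum_(s in B) w ^+ (j * (q + s)).
    rewrite /fset_hat big_distrlr; apply: eq_bigr => q _; apply: eq_bigr => s _.
    by rewrite mulnDr exprD.
  rewrite exprS expr2 F2 /fset_hat mulr_suml scaler_suml; apply: eq_bigr => p _.
  rewrite mulr_sumr scaler_suml; apply: eq_bigr => q _.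
  rewrite mulr_sumr scaler_suml; apply: eq_bigr => s _.
  by rewrite -exprD -mulnDr addnA.
rewrite exchange_big; apply: eq_bigr => p _.
rewrite exchange_big; apply: eq_bigr => q _.
rewrite exchange_big; apply: eq_bigr => s _.
exact: fourier_inversion.
Qed.

Lemma parseval : \sum_(j < g) nm (fset_hat j) ^+ 2 = g%:R * #|B|%:R.
Proof.
apply: complexI; rewrite rmorph_sum rmorphM !rmorph_nat.
transitivity (\sum_(j < g) \sum_(p in B) \sum_(q in B) (w ^+ (j * p) * w^-1 ^+ (j * q))).
  apply: eq_bigr => j _; rewrite rmorphXn /= -nmE normCK /fset_hat mulr_suml.
  apply: eq_bigr => p _; rewrite rmorph_sum mulr_sumr; apply: eq_bigr => q _.
  by rewrite rmorphXn /= conj_w.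
rewrite exchange_big /= mulr_natr -sumr_const; apply: eq_bigr => p pB.
rewrite exchange_big /= (bigD1 p)//= orthogonality eqxx big1 ?addr0// => q /andP[_ qp].
rewrite orthogonality; case: ifPn => // /eqP; rewrite !modn_small// => /val_inj/esym/eqP.
by rewrite (negbTE qp).
Qed.

(** The Fourier coefficients are eigenvectors up to the failure of g-periodicity. *)
Lemma orbit_fourier_shift j :
  T (orbit_fourier j) - w ^+ j *: orbit_fourier j = (w ^+ j * g%:R^-1) *: (iter g T r - r).
Proof.
pose b k := w^-1 ^+ (j * k) *: iter k T r.
have e1 : T (orbit_fourier j) = (w ^+ j * g%:R^-1) *: \sum_(k < g) b k.+1.
  rewrite /orbit_fourier linearZ /= mulrC -scalerA; congr (_ *: _).
  rewrite linear_sum scaler_sumr; apply: eq_bigr => k _.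
  by rewrite /b linearZ /= scalerA mulnS exprD mulrA -exprMn mulfV ?w_neq0// expr1n mul1r.
have e2 : orbit_fourier j = g%:R^-1 *: \sum_(k < g) b k by [].
rewrite e1 e2 scalerA -scalerBr -sumrB -(big_mkord xpredT (fun k => b k.+1 - b k)).
rewrite telescope_sumr// /b muln0 expr0 scale1r mulnC exprM exprVn (prim_expr_order wg).
by rewrite invr1 expr1n scale1r.
Qed.

End FiniteFourier.

(** * Recurrent vectors of a power-bounded operator *)

Section Recurrence.
Variables (R : realType) (V : completeNormedModType R[i]) (T : {linear V -> V}) (M : R).
Hypotheses (M1 : 1 <= M) (TM : forall n x, nm (iter n T x) <= M * nm x).
Hypothesis (Tc : forall x, precompact [set iter n T x | n in [set: nat]]).
Implicit Types (x y r : V) (e : R).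

(** Returns to each neighbourhood at arbitrarily large times. *)
Definition recurrent r :=
  forall e, 0 < e -> forall N, exists2 g, (N <= g)%N & nm (iter g T r - r) < e.

Lemma bound_gt0 : 0 < M. Proof. exact: lt_le_trans M1. Qed.

Lemma iterB n x y : iter n T (x - y) = iter n T x - iter n T y.
Proof. exact: linearB. Qed.

Lemma nm_iterB n x y : nm (iter n T x - iter n T y) <= M * nm (x - y).
Proof. by rewrite -iterB. Qed.

(** Differences of visiting times of the orbit of a near r are return times of r. *)
Lemma cluster_recurrent a r :
  (forall e, 0 < e -> forall N, exists2 n, (N <= n)%N & nm (iter n T a - r) < e) ->
  recurrent r.
Proof.
move=> h e e0 N; have d0 : 0 < e / (M + 1) by rewrite divr_gt0// addr_gt0// bound_gt0.
have [n _ hn] := h _ d0 0%N.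
have [n' nn' hn'] := h _ d0 (N + n)%N.
exists (n' - n)%N; first by rewrite leq_subRL ?(leq_trans _ nn')// ?leq_addl// addnC.
rewrite (le_lt_trans (nm_dist (iter n' T a) _ _))//.
have -> : iter n' T a = iter (n' - n) T (iter n T a).
  by rewrite -iterD subnK// (leq_trans _ nn')// leq_addl.
have := nm_iterB (n' - n) r (iter n T a); rewrite nmBC in hn.
move: hn'; rewrite -[in X in X -> _](subnK (leq_trans (leq_addl N n) nn')) iterD => hn'.
have : e = e / (M + 1) * (M + 1) by rewrite divfK// gt_eqF// addr_gt0// bound_gt0.
have := bound_gt0; move: (e / (M + 1)) hn hn' => d; nra.
Qed.

Lemma orbit_cluster (a : V) (m : nat -> nat) : exists r,
  forall e, 0 < e -> forall N, exists2 k, (N <= k)%N & nm (iter (m k) T a - r) < e.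
Proof.
have [U UU UN] := free_ultra.
have := Tc a; rewrite precompactE => cK.
have [|r _ /ulimP hr] := @ulim_compact U UU _ _ (fun k => iter (m k) T a) cK.
  by move=> n; apply: subset_closure; exists (m n).
exists r => e e0 N.
have [k [/= kN ke]] := filter_ex (filterI (UN N) (hr _ e0)).
by exists k.
Qed.

(** Let r be a cluster point of T^m a along times m for which some n makes
    T^n (T^m a - a) small; then T^n (r - a) is small for some n, hence for all
    large n. *)
Lemma recurrent_stable_decomposition a : exists2 r, recurrent r &
  forall e, 0 < e -> exists N, forall n, (N <= n)%N -> nm (iter n T (a - r)) < e.
Proof.
have [r0 hr0] := orbit_cluster a id.
(* p is the pair (m, n), obtained from two visits n and n + m near r0. *)
have /choice[p hp] : forall N : nat, exists p : nat * nat, (N <= p.1)%N /\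
    nm (iter p.2 T (iter p.1 T a - a)) < N.+1%:R^-1.
  move=> N; have d0 : 0 < (N.+1%:R^-1 : R) / 2 by rewrite divr_gt0// invr_gt0 ltr0n.
  have [n _ hn] := hr0 _ d0 0%N; have [n' nn' hn'] := hr0 _ d0 (N + n)%N.
  exists (n' - n, n)%N => /=; split.
    by rewrite leq_subRL ?(leq_trans _ nn')// ?leq_addl// addnC.
  rewrite iterB -iterD subnKC ?(leq_trans _ nn')// ?leq_addl//.
  rewrite (le_lt_trans (nm_dist r0 _ _))// [X in _ < X]splitr ltrD//.
  by rewrite nmBC.
have [r hr] := orbit_cluster a (fun k => (p k).1).
exists r.
  apply: (@cluster_recurrent a) => e e0 N.
  have [k kN ke] := hr _ e0 N; exists (p k).1 => //.
  by rewrite (leq_trans kN)//; have [] := hp k.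
move=> e e0; have d0 : 0 < e / (M * (M + 1)).
  by rewrite divr_gt0// mulr_gt0// ?addr_gt0// bound_gt0.
set d := e / _ in d0.
have [k kN ke] := hr _ d0 (Num.truncn d^-1); have [_ hk] := hp k.
have kd : (k.+1%:R^-1 : R) < d.
  rewrite -[d]invrK ltf_pV2 ?posrE ?invr_gt0 ?ltr0n//.
  by rewrite (lt_le_trans (truncnS_gt _))// ler_nat.
exists (p k).2 => n /subnK <-; rewrite iterD.
rewrite (le_lt_trans (TM _ _))//.
have : nm (iter (p k).2 T (a - r)) < (M + 1) * d.
  rewrite iterB (le_lt_trans (nm_dist (iter (p k).2 T (iter (p k).1 T a)) _ _))//.
  have := nm_iterB (p k).2 (iter (p k).1 T a) r.
  rewrite iterB nmBC in hk; have := lt_trans hk kd.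
  have : M * nm (iter (p k).1 T a - r) < M * d by rewrite ltr_pM2l// bound_gt0.
  lra.
have -> : e = M * ((M + 1) * d).
  by rewrite mulrA [RHS]mulrC /d divfK// gt_eqF// mulr_gt0 ?addr_gt0// bound_gt0.
by move=> ?; rewrite ltr_pM2l// bound_gt0.
Qed.

Lemma recurrent_lower_bound y l : recurrent y -> nm y <= M * nm (iter l T y).
Proof.
move=> ry; apply/ler_addgt0Pr => e e0; have [g lg ge] := ry _ e0 l.
have := nmD (y - iter g T y) (iter g T y); rewrite subrK nmBC.
have := TM (g - l) (iter l T y); rewrite -iterD subnK//; lra.
Qed.

Lemma recurrent_orbit_diff r k : recurrent r -> recurrent (iter k T r - r).
Proof.
move=> rr e e0 N; have d0 : 0 < e / (M + 1) by rewrite divr_gt0// addr_gt0// bound_gt0.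
have [g gN ge] := rr _ d0 N; exists g => //.
have -> : iter g T (iter k T r - r) - (iter k T r - r) =
    iter k T (iter g T r - r) - (iter g T r - r).
  by rewrite !iterB -!iterD addnC !opprB addrACA [RHS]addrACA; congr (_ + _); rewrite addrC.
have := nmB (iter k T (iter g T r - r)) (iter g T r - r).
have := TM k (iter g T r - r).
have : e = e / (M + 1) * (M + 1) by rewrite divfK// gt_eqF// addr_gt0// bound_gt0.
have := bound_gt0; move: (e / (M + 1)) ge => d; nra.
Qed.

(** The absolutely convex hull of the orbit of r. The coefficients of an element
    are listed along an initial segment of the orbit. *)
Definition orbit_hull r x := exists (n : nat) (c : 'I_n -> R[i]),
  \sum_(k < n) nm (c k) <= 1 /\ x = \sum_(k < n) c k *: iter k T r.

Lemma nm_orbit_hull r x : orbit_hull r x -> nm x <= M * nm r.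
Proof.
move=> [n [c [c1 ->]]]; rewrite (le_trans (nm_sum _ _ _))//.
apply: (@le_trans _ _ (\sum_(k < n) nm (c k) * (M * nm r))).
  by apply: ler_sum => k _; rewrite nmZ ler_wpM2l ?nm_ge0.
by rewrite -mulr_suml ler_piMl// mulr_ge0 ?nm_ge0// ltW// bound_gt0.
Qed.

Lemma orbit_hull_scale r x c : nm c <= 1 -> orbit_hull r x -> orbit_hull r (c *: x).
Proof.
move=> c1 [n [d [d1 ->]]]; exists n, (fun k => c * d k); split.
  under eq_bigr do rewrite nm_mulc.
  by rewrite -mulr_sumr mulr_ile1 ?nm_ge0// sumr_ge0// => i _; exact: nm_ge0.
by rewrite scaler_sumr; apply: eq_bigr => k _; rewrite scalerA.
Qed.

Lemma orbit_hull0 r : orbit_hull r 0.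
Proof.
exists 0%N, (fun=> 0); rewrite !big_ord0; split=> //; exact: ler01.
Qed.

(** Total boundedness: each orbit point is replaced by a point of a finite net for
    the orbit, and the coefficients are collected. *)
Lemma orbit_hull_net r e : 0 < e -> exists (K : nat) (s : 'I_K -> V),
  forall x, orbit_hull r x -> exists d : 'I_K -> R[i],
    (forall i, nm (d i) <= 1) /\ nm (x - \sum_(i < K) d i *: s i) <= e.
Proof.
move=> e0; have [K [s hs]] := precompact_net (Tc r) e0; exists K, s.
move=> _ [n [c [c1 ->]]].
have /choice[f hf] : forall k : nat, exists i, nm (iter k T r - s i) < e.
  by move=> k; apply: hs; exists k.
exists (fun i => \sum_(k < n | f k == i) c k); split.
  move=> i; rewrite (le_trans (nm_sum _ _ _))// (le_trans _ c1)//.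
  by rewrite big_mkcond ler_sum// => k _; case: ifP => // _; rewrite ?nm_ge0.
have -> : \sum_(i < K) (\sum_(k < n | f k == i) c k) *: s i = \sum_(k < n) c k *: s (f k).
  rewrite [RHS](partition_big (fun k : 'I_n => f k) xpredT)//=; apply: eq_bigr => i _.
  by rewrite scaler_suml; apply: eq_bigr => k /eqP ->.
rewrite -sumrB (le_trans (nm_sum _ _ _))//.
apply: (@le_trans _ _ (\sum_(k < n) nm (c k) * e)).
  by apply: ler_sum => k _; rewrite -scalerBr nmZ ler_wpM2l ?nm_ge0// ltW.
by rewrite -mulr_suml ler_piMl// ltW.
Qed.

Lemma orbit_hull_ulim (U : set_system nat) (UU : UltraFilter U) r (x : nat -> V) :
  (forall n, orbit_hull r (x n)) -> exists l : V, ulim U x l.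
Proof.
move=> xh; apply: ulim_cauchy => e e0; have e2 : 0 < e / 2 by rewrite divr_gt0.
have [K [s hs]] := orbit_hull_net r e2.
have /choice[d hd] : forall n, exists d : 'I_K -> R[i],
    (forall i, nm (d i) <= 1) /\ nm (x n - \sum_(i < K) d i *: s i) <= e / 2.
  by move=> n; apply: hs.
have /choice[l hl] : forall i : 'I_K, exists l : R[i],
    ulim U ((fun n => d n i) : nat -> R[i]^o) l.
  by move=> i; apply: (@ulim_bounded_complex _ _ _ _ 1) => n; have [] := hd n.
exists (\sum_(i < K) l i *: s i).
have lim : ulim U (fun n => \sum_(i < K) d n i *: s i) (\sum_(i < K) l i *: s i).
  apply: (@ulim_sum _ _ _ _ _ (fun i n => d n i *: s i)) => i.
  by apply: ulimZ; [by have /ulimP := hl i|exact: ulim_cst].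
have := lim _ e2; apply: (@filterS _ U) => n /= h.
rewrite (le_lt_trans (nm_dist (\sum_(i < K) d n i *: s i) _ _))//.
by rewrite [X in _ < X]splitr ler_ltD//; have [] := hd n.
Qed.

End Recurrence.

(** * Return times *)

Section Returns.
Variables (R : realType) (V : completeNormedModType R[i]) (T : {linear V -> V}) (M : R).
Hypotheses (M1 : 1 <= M) (TM : forall n x, nm (iter n T x) <= M * nm x).
Hypothesis (Tc : forall x, precompact [set iter n T x | n in [set: nat]]).
Implicit Types (x y r : V) (e : R).

Let M_gt0 : 0 < M := bound_gt0 M1.

Lemma nm_iter_mul g r m :
  nm (iter (g * m) T r - r) <= m%:R * (M * nm (iter g T r - r)).
Proof.
elim: m => [|m ih]; first by rewrite muln0 /= subrr nm0 mul0r.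
rewrite mulnS addnC iterD (le_trans (nm_dist (iter (g * m) T r) _ _))//.
by rewrite -natr1 mulrDl mul1r addrC lerD// nm_iterB.
Qed.

Lemma nm_iter_modn g r n :
  nm (iter n T r - iter (n %% g) T r) <= M * ((n %/ g)%:R * (M * nm (iter g T r - r))).
Proof.
rewrite {1}(divn_eq n g) addnC iterD mulnC (le_trans (nm_iterB TM _ _ _))//.
by rewrite ler_wpM2l ?(ltW M_gt0)// nm_iter_mul.
Qed.

Lemma pigeonhole (K g : nat) (f : 'I_g -> 'I_K) : (0 < g)%N ->
  exists i, (g <= K * #|[set k | f k == i]%SET|)%N.
Proof.
move=> g0; apply: contrapT => /forallNP h.
have lt i : (K * #|[set k | f k == i]%SET| < g)%N.
  by rewrite ltnNge; apply/negP; exact: h.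
have K0 : (0 < K)%N by case: (K) f {h lt} => [f|//]; case: (f (Ordinal g0)).
have : (K * g <= \sum_(i < K) g.-1)%N.
  rewrite -{1}[g]card_ord -sum1_card (partition_big f xpredT)//= big_distrr /=.
  apply: leq_sum => i _; rewrite -ltnS prednK// (leq_ltn_trans _ (lt i))//.
  by rewrite sum1dep_card.
by rewrite sum_nat_const card_ord leq_pmul2l// leqNgt prednK// leqnn.
Qed.

(** In a partition of the orbit segment into K cells of small diameter, some cell
    has at least g / K points; subtracting its least index turns its indices
    into return times. *)
Lemma return_density r e : recurrent T r -> 0 < e -> exists K : nat,
  forall g, (0 < g)%N -> (g <= K * #|[set k : 'I_g | (nm (iter k T r - r) <= e)%R]%SET|)%N.
Proof.
move=> rr e0; pose d := e / (2 * M).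
have d0 : 0 < d by rewrite divr_gt0// mulr_gt0.
have [K [s hs]] := precompact_net (Tc r) d0; exists K => g g0.
have /choice[f hf] : forall k : nat, exists i, nm (iter k T r - s i) < d.
  by move=> k; apply: hs; exists k.
have [i hi] := @pigeonhole K g (fun k => f k) g0.
set C := [set k : 'I_g | f k == i]%SET in hi.
rewrite (leq_trans hi)// leq_mul2l; apply/orP; right.
have [k0 k0C] : exists k0, k0 \in C.
  by apply/card_gt0P; move: hi; case: #|C| => //; rewrite muln0 leqNgt g0.
case: (@arg_minnP _ k0 (mem C) val k0C) => l lC lmin.
pose h (k : 'I_g) := Ordinal (leq_ltn_trans (leq_subr l k) (ltn_ord k)).
have hinj : {in C &, injective h}.
  move=> k k' /lmin kl /lmin kl' [] /eqP; rewrite eqn_sub2rE// => /eqP; exact: val_inj.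
rewrite -(card_in_imset hinj); apply: subset_leq_card.
apply/fintype.subsetP => _ /imsetP[k kC ->]; rewrite inE /=.
have lk := lmin _ kC.
have rd := recurrent_orbit_diff M1 TM (k - l) rr.
rewrite (le_trans (recurrent_lower_bound TM l rd))//.
rewrite iterB -iterD subnKC//.
move: kC lC; rewrite !inE => /eqP fk /eqP fl.
have hk := hf k; have hl := hf l; rewrite fk in hk; rewrite fl nmBC in hl.
have : nm (iter k T r - iter l T r) <= 2 * d.
  by rewrite (le_trans (nm_dist (s i) _ _))// mulr_natl mulr2n lerD// ltW.
have -> : e = M * (2 * d) by rewrite mulrA [RHS]mulrC [M * 2]mulrC /d divfK// gt_eqF// mulr_gt0.
by move=> ?; rewrite ler_wpM2l// ltW.
Qed.

(** Sums of three return times are return times, up to the reduction modulo g,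
    which is controlled by the return at time g because the quotient by g is at
    most 3. *)
Lemma return_triple r e g (p q s : 'I_g) : (0 < g)%N ->
  nm (iter p T r - r) <= e -> nm (iter q T r - r) <= e -> nm (iter s T r - r) <= e ->
  nm (iter ((p + q + s) %% g) T r - r) <= 3 * M * e + 3 * M ^+ 2 * nm (iter g T r - r).
Proof.
move=> g0 hp hq hs.
have h1 := nm_iter_modn g r (p + q + s); rewrite nmBC in h1.
have dg : ((p + q + s) %/ g)%:R <= 3 :> R.
  rewrite (ler_nat R _ 3) -ltnS ltn_divLR//.
  by have := ltn_ord p; have := ltn_ord q; have := ltn_ord s; lia.
have h2 := nm_dist (iter (p + q + s) T r) (iter ((p + q + s) %% g) T r) r.
have h3 := nm_dist (iter (p + q) T r) (iter (p + q + s) T r) r.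
have h4 := nm_dist (iter p T r) (iter (p + q) T r) r.
have h5 : nm (iter (p + q + s) T r - iter (p + q) T r) <= M * e.
  by rewrite iterD (le_trans (nm_iterB TM _ _ _))// ler_wpM2l// ltW.
have h6 : nm (iter (p + q) T r - iter p T r) <= M * e.
  by rewrite iterD (le_trans (nm_iterB TM _ _ _))// ler_wpM2l// ltW.
have e0 : 0 <= e by rewrite (le_trans _ hp)// nm_ge0.
have h7 : e <= M * e by rewrite ler_peMl.
have h8 : M * (((p + q + s) %/ g)%:R * (M * nm (iter g T r - r))) <=
    3 * M ^+ 2 * nm (iter g T r - r).
  rewrite expr2 mulrCA -!mulrA ler_wpM2r//; rewrite !mulr_ge0 ?nm_ge0// ltW//.
lra.
Qed.

End Returns.

(** * Approximate eigenvectors *)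

Section ApproximateEigenvectors.
Variables (R : realType) (V : completeNormedModType R[i]) (T : {linear V -> V}) (M : R).
Hypotheses (M1 : 1 <= M) (TM : forall n x, nm (iter n T x) <= M * nm x).
Variables (r : V) (g : nat) (w : R[i]) (B : {set 'I_g}).
Hypotheses (g0 : (0 < g)%N) (wg : g.-primitive_root w) (B0 : (0 < #|B|)%N).

Let M_gt0 : 0 < M := bound_gt0 M1.
Local Notation F := (orbit_fourier T r g w).

(** Fourier transform of the uniform probability on B. *)
Definition uhat (j : nat) : R[i] := fset_hat w B j / #|B|%:R.

Let BC0 : (#|B|%:R : R[i]) != 0. Proof. by rewrite pnatr_eq0 -lt0n. Qed.
Let BR0 : (0 : R) < #|B|%:R. Proof. by rewrite ltr0n. Qed.

Lemma nm_natV n : nm (n%:R^-1 : R[i]) = n%:R^-1.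
Proof. by rewrite -(rmorph_nat (real_complex R)) -fmorphV nmC ger0_norm// invr_ge0. Qed.

Lemma nm_uhat_le1 j : nm (uhat j) <= 1.
Proof.
rewrite /uhat nm_mulc nm_natV ler_pdivrMr// mul1r (le_trans (nm_sum _ _ _))//.
rewrite -sumr_const ler_sum// => p _.
by rewrite nm_expc (nm_w g0 wg) expr1n.
Qed.

Lemma sum_uhat_sqr : \sum_(j < g) nm (uhat j) ^+ 2 = g%:R / #|B|%:R.
Proof.
transitivity (\sum_(j < g) nm (fset_hat w B j) ^+ 2 * (#|B|%:R ^+ 2)^-1).
  by apply: eq_bigr => j _; rewrite /uhat nm_mulc nm_natV exprMn exprVn.
by rewrite -mulr_suml (parseval g0 wg) expr2 invfM mulrA mulfK// gt_eqF.
Qed.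

Lemma uhat_average C :
  (forall p q s, p \in B -> q \in B -> s \in B ->
     nm (iter ((p + q + s) %% g) T r - r) <= C) ->
  nm (\sum_(j < g) uhat j ^+ 3 *: F j - r) <= C.
Proof.
move=> hC; set b : R[i] := #|B|%:R.
have -> : \sum_(j < g) uhat j ^+ 3 *: F j - r = b^-1 ^+ 3 *:
    \sum_(p in B) \sum_(q in B) \sum_(s in B) (iter ((p + q + s) %% g) T r - r).
  have -> : \sum_(p in B) \sum_(q in B) \sum_(s in B) (iter ((p + q + s) %% g) T r - r) =
     \sum_(p in B) \sum_(q in B) \sum_(s in B) iter ((p + q + s) %% g) T r - b ^+ 3 *: r.
    under eq_bigr => p _ do (under eq_bigr => q _ do rewrite sumrB sumr_const;
      rewrite sumrB sumr_const).
    rewrite sumrB sumr_const; congr (_ - _).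
    by rewrite -!mulrnA /b -natrX scaler_nat !expnS expn0 muln1 mulnA.
  rewrite scalerBr -(fset_hat_cube _ _ g0 wg) scaler_sumr scalerA exprVn mulVf ?expf_neq0//.
  rewrite scale1r; congr (_ - _); apply: eq_bigr => j _.
  by rewrite [RHS]scalerA /uhat exprMn exprVn mulrC.
rewrite nmZ nm_expc nm_natV.
apply: (@le_trans _ _ (#|B|%:R^-1 ^+ 3 * (C *+ #|B| *+ #|B| *+ #|B|))).
  rewrite ler_wpM2l ?exprn_ge0 ?invr_ge0//.
  rewrite -sumr_const (le_trans (nm_sum _ _ _))// ler_sum// => p pB.
  rewrite -sumr_const (le_trans (nm_sum _ _ _))// ler_sum// => q qB.
  rewrite -sumr_const (le_trans (nm_sum _ _ _))// ler_sum// => s sB.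
  exact: hC.
rewrite -!mulrnA -[C *+ _]mulr_natl (_ : (_ * _)%:R = #|B|%:R ^+ 3); last first.
  by rewrite !natrM !exprS expr0 mulr1 mulrA.
by rewrite exprVn mulKf// expf_neq0// gt_eqF.
Qed.

Lemma orbit_fourier_hull j : orbit_hull T r (F j).
Proof.
exists g, (fun k => g%:R^-1 * w^-1 ^+ (j * k)); split; last first.
  by rewrite /orbit_fourier scaler_sumr; apply: eq_bigr => k _; rewrite scalerA.
rewrite (eq_bigr (fun=> g%:R^-1)) => [|k _].
  by rewrite sumr_const card_ord -[_ *+ g]mulr_natr mulVf// pnatr_eq0 -lt0n.
by rewrite nm_mulc nm_natV nm_expc (nm_wV g0 wg) expr1n mulr1.
Qed.

Lemma uhat_hull j : orbit_hull T r (uhat j ^+ 3 *: F j).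
Proof.
apply: orbit_hull_scale; last exact: orbit_fourier_hull.
by rewrite nm_expc exprn_ile1 ?nm_ge0// nm_uhat_le1.
Qed.

Lemma uhat_eigen j : nm (T (uhat j ^+ 3 *: F j) - w ^+ j *: (uhat j ^+ 3 *: F j)) <=
  nm (iter g T r - r).
Proof.
have := orbit_fourier_shift T r g0 wg j; move: (F j) => f hf.
have -> : T (uhat j ^+ 3 *: f) = uhat j ^+ 3 *: T f by rewrite linearZ.
rewrite scalerA [w ^+ j * _]mulrC -[X in _ - X]scalerA -scalerBr hf.
rewrite !nmZ nm_mulc !nm_expc nm_natV (nm_w g0 wg) expr1n mul1r.
rewrite mulrA ler_piMl ?nm_ge0// mulr_ile1 ?exprn_ge0 ?nm_ge0 ?invr_ge0//.
  by rewrite exprn_ile1 ?nm_ge0// nm_uhat_le1.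
by rewrite invf_le1 ?ler1n// ltr0n.
Qed.

Variables (K : nat) (d : R).
Hypotheses (gK : (g <= K * #|B|)%N) (d0 : 0 < d).

(** The frequencies at which the transform is at least d in modulus. *)
Definition large : {set 'I_g} := [set j : 'I_g | d <= nm (uhat j)]%SET.

Lemma sum_uhat_sqr_le : \sum_(j < g) nm (uhat j) ^+ 2 <= K%:R.
Proof. by rewrite sum_uhat_sqr ler_pdivrMr// -natrM ler_nat. Qed.

(** Chebyshev's inequality applied to Parseval's identity; the bound does not
    depend on g. *)
Lemma card_large : (#|large| <= Num.truncn (K%:R / d ^+ 2))%N.
Proof.
have d2 : 0 < d ^+ 2 by rewrite exprn_gt0.
have le : #|large|%:R * d ^+ 2 <= K%:R.
  rewrite (le_trans _ sum_uhat_sqr_le)// mulr_natl -sumr_const.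
  rewrite [X in _ <= X](bigID (mem large))/= ler_wpDr//.
    by apply: sumr_ge0 => j _; rewrite exprn_ge0 ?nm_ge0.
  by apply: ler_sum => j; rewrite inE => dj; rewrite ler_pXn2r ?nnegrE ?nm_ge0// ltW.
by rewrite truncn_ge_nat ?divr_ge0 ?ler0n ?(ltW d2)// ler_pdivlMr.
Qed.

Lemma small_part : nm (\sum_(j < g | j \notin large) uhat j ^+ 3 *: F j) <=
  d * K%:R * (M * nm r).
Proof.
rewrite (le_trans (nm_sum _ _ _))//.
apply: (@le_trans _ _ (\sum_(j < g | j \notin large) d * nm (uhat j) ^+ 2 * (M * nm r))).
  apply: ler_sum => j; rewrite inE -ltNge => jd.
  rewrite nmZ nm_expc exprS ler_pM ?mulr_ge0 ?exprn_ge0 ?nm_ge0//.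
    by rewrite ler_wpM2r ?exprn_ge0 ?nm_ge0// ltW.
  by rewrite (nm_orbit_hull M1 TM)//; exact: orbit_fourier_hull.
rewrite -mulr_suml -mulr_sumr ler_wpM2r ?mulr_ge0 ?nm_ge0 ?(ltW M_gt0)//.
rewrite ler_wpM2l ?(ltW d0)// (le_trans _ sum_uhat_sqr_le)//.
rewrite [X in _ <= X](bigID (mem large))/= ler_wpDl//.
by apply: sumr_ge0 => j _; rewrite exprn_ge0 ?nm_ge0.
Qed.

(** The sum over the large frequencies, padded with zero vectors to exactly m terms. *)
Lemma large_decomposition m : (#|large| <= m)%N ->
  exists (y : 'I_m -> V) (l : 'I_m -> R[i]),
   (forall i, [/\ nm (l i) = 1, orbit_hull T r (y i) &
      nm (T (y i) - l i *: y i) <= nm (iter g T r - r)]) /\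
   \sum_(j in large) uhat j ^+ 3 *: F j = \sum_(i < m) y i.
Proof.
move=> Lm; pose j0 := Ordinal g0; pose s := enum large.
have sm : (size s <= m)%N by rewrite -cardE.
exists (fun i => if (i < size s)%N then uhat (nth j0 s i) ^+ 3 *: F (nth j0 s i) else 0).
exists (fun i => w ^+ (nth j0 s i)); split.
  move=> i; split; first by rewrite nm_expc (nm_w g0 wg) expr1n.
    by case: ifP => _; [exact: uhat_hull|exact: orbit_hull0].
  case: ifP => _; first exact: uhat_eigen.
  by rewrite linear0 scaler0 subrr nm0 nm_ge0.
rewrite -big_mkcond /= -(big_ord_widen m (fun i => uhat (nth j0 s i) ^+ 3 *: F (nth j0 s i)) sm).
by rewrite -big_enum (big_nth j0) big_mkord.
Qed.

End ApproximateEigenvectors.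

(** * Recurrent vectors and unimodular eigenvectors *)

Section UnimodularSpectrum.
Variables (R : realType) (V : completeNormedModType R[i]) (T : {linear V -> V}) (M : R).
Hypotheses (M1 : 1 <= M) (TM : forall n x, nm (iter n T x) <= M * nm x).
Hypothesis (Tc : forall x, precompact [set iter n T x | n in [set: nat]]).
Implicit Types (x y r : V) (e : R).

Let M_gt0 : 0 < M := bound_gt0 M1.

(** The number m of terms depends on r and e but not on eta, which is what allows
    the passage to the limit in [recurrent_eigendecomposition]. *)
Lemma approximate_eigendecomposition r e : recurrent T r -> 0 < e ->
  exists m : nat, forall eta : R, 0 < eta ->
  exists (y : 'I_m -> V) (l : 'I_m -> R[i]),
   (forall i, [/\ nm (l i) = 1, orbit_hull T r (y i) & nm (T (y i) - l i *: y i) <= eta]) /\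
   nm (r - \sum_(i < m) y i) <= e.
Proof.
(* rho, d and the bound on the return at time g are chosen so that each of the
   three errors is at most e / 3. *)
move=> rr e0; pose rho := e / (9 * M).
have rho0 : 0 < rho by rewrite divr_gt0// mulr_gt0.
have [K hK] := return_density M1 TM Tc rr rho0.
pose D := 3 * (K%:R + 1) * (M * (nm r + 1)).
have K1 : 0 < K%:R + 1 :> R by rewrite ltr_wpDl ?ler0n.
have D0 : 0 < D by rewrite !mulr_gt0// nm1_gt0.
pose d := e / D; have d0 : 0 < d by rewrite divr_gt0.
exists (Num.truncn (K%:R / d ^+ 2)) => eta eta0.
have z0 : 0 < Num.min eta (e / (9 * M ^+ 2)).
  by rewrite lt_min eta0 divr_gt0// mulr_gt0// exprn_gt0.
have [g g0] := rr _ z0 1%N; rewrite lt_min => /andP[geta gM].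
have gK := hK g g0; set B := [set k : 'I_g | _]%SET in gK.
have B0 : (0 < #|B|)%N by move: gK; case: #|B| => //; rewrite muln0 leqNgt g0.
have [w wg] := prim_root_complex R g0.
have [y [l [hyl hy]]] := large_decomposition T r g0 wg B0 (card_large g0 wg B0 gK d0).
exists y, l; split.
  by move=> i; have [? ? le] := hyl i; split=> //; rewrite (le_trans le)// ltW.
rewrite -hy.
have av := @uhat_average _ _ T r g w B g0 wg B0 (3 * M * rho + 3 * M ^+ 2 * nm (iter g T r - r)).
have {}av := av _; rewrite (bigID (mem (large w B d)))/= in av.
have sp := small_part M1 TM r g0 wg B0 gK d0.
set L := \sum_(j < g | j \in _) _ in av *; set S := \sum_(j < g | j \notin _) _ in av sp *.
have e1 : 3 * M * rho = e / 3.
  by rewrite /rho; field; rewrite gt_eqF.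
have e2 : 3 * M ^+ 2 * nm (iter g T r - r) <= e / 3.
  have -> : e / 3 = 3 * M ^+ 2 * (e / (9 * M ^+ 2)) by field; rewrite gt_eqF.
  by rewrite ler_wpM2l ?mulr_ge0 ?exprn_ge0 ?(ltW M_gt0)// ltW.
have e3 : d * K%:R * (M * nm r) <= e / 3.
  have -> : e / 3 = d * (K%:R + 1) * (M * (nm r + 1)).
    rewrite /d /D; field; rewrite !gt_eqF ?nm1_gt0//.
  have dK : 0 <= d * K%:R by apply: mulr_ge0 => //; exact: ltW.
  apply: ler_pM => //; first by rewrite mulr_ge0 ?nm_ge0 ?(ltW M_gt0).
    by rewrite ler_wpM2l ?(ltW d0)// lerDl.
  by rewrite ler_wpM2l ?(ltW M_gt0)// lerDl.
have hav : nm (L + S - r) <= 3 * M * rho + 3 * M ^+ 2 * nm (iter g T r - r).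
  by apply: av => p q s; rewrite !inE => hp hq hs; exact: return_triple.
have e4 : L + S - L = S by rewrite addrAC subrr add0r.
have := nm_dist (L + S) r L; rewrite e4 (nmBC r (L + S)).
move: hav sp; lra.
Qed.

(** Limit, along an ultrafilter, of the approximate decompositions with
    eta = 1 / (n + 1). *)
Lemma recurrent_eigendecomposition r e : recurrent T r -> 0 < e ->
  exists (m : nat) (y : 'I_m -> V) (l : 'I_m -> R[i]),
   (forall i, nm (l i) = 1 /\ T (y i) = l i *: y i) /\
   nm (r - \sum_(i < m) y i) <= e.
Proof.
move=> rr e0; have [m hm] := approximate_eigendecomposition rr e0.
have [U UU UN] := free_ultra.
have /choice[yl hyl] : forall n : nat, exists yl : ('I_m -> V) * ('I_m -> R[i]),
   (forall i, [/\ nm (yl.2 i) = 1, orbit_hull T r (yl.1 i) &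
       nm (T (yl.1 i) - yl.2 i *: yl.1 i) <= n.+1%:R^-1]) /\
   nm (r - \sum_(i < m) yl.1 i) <= e.
  move=> n; have [|y [l h]] := hm n.+1%:R^-1; first by rewrite invr_gt0 ltr0n.
  by exists (y, l).
have /choice[y hy] : forall i : 'I_m, exists z : V, ulim U (fun n => (yl n).1 i) z.
  move=> i; apply: (@orbit_hull_ulim _ _ T Tc U UU r) => n.
  by have [h _] := hyl n; have [] := h i.
have /choice[l hl] : forall i : 'I_m, exists z : R[i],
    ulim U ((fun n => (yl n).2 i) : nat -> R[i]^o) z.
  move=> i; apply: (@ulim_bounded_complex _ _ _ _ 1) => n.
  by have [h _] := hyl n; have [->] := h i.
exists m, y, l; split => [i|]; last first.
  apply: (@ulim_le _ U _ _ (fun n => r - \sum_(i < m) (yl n).1 i)).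
    by apply: ulimB; [exact: ulim_cst|exact: (@ulim_sum _ _ _ _ _ (fun i n => (yl n).1 i))].
  move=> z z0; apply: (@filterS _ U _ setT); last exact: filterT.
  by move=> n _ /=; have [_ le] := hyl n; rewrite (le_trans le)// lerDl ltW.
split.
  have le1 : nm (l i) <= 1.
    apply: (@ulim_le _ U _ R[i]^o _ _ _ (hl i)) => z z0.
    apply: (@filterS _ U _ setT); last exact: filterT.
    by move=> n _ /=; have [h _] := hyl n; have [-> _ _] := h i; rewrite lerDl ltW.
  apply/eqP; rewrite eq_le le1 /=; apply/ler_addgt0Pr => z z0.
  have [n /= hn] := filter_ex (hl i _ z0).
  have [h _] := hyl n; have [h1 _ _] := h i.
  by have := nmD ((yl n).2 i - l i) (l i); rewrite subrK h1; move: hn; lra.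
apply/eqP; rewrite -subr_eq0; apply/eqP/nm0_eq0/eqP; rewrite eq_le nm_ge0 andbT.
have lT : ulim U (fun n => T ((yl n).1 i)) (T (y i)).
  move=> z z0; have zM : 0 < z / M by rewrite divr_gt0.
  have := hy i _ zM; apply: (@filterS _ U) => n /= hn.
  rewrite -linearB (le_lt_trans (TM 1 _))//.
  by rewrite mulrC -ltr_pdivlMr.
apply: (@ulim_le _ U _ _ (fun n => T ((yl n).1 i) - (yl n).2 i *: (yl n).1 i)).
  apply: ulimB => //; apply: ulimZ => //.
  by have /ulimP := hl i.
move=> z z0; have := UN (Num.truncn z^-1); apply: (@filterS _ U) => n /= hn.
have [h _] := hyl n; have [_ _ le] := h i; rewrite add0r (le_trans le)//.
rewrite -[z]invrK lef_pV2 ?posrE ?invr_gt0 ?ltr0n// ltW//.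
by rewrite (lt_le_trans (truncnS_gt _))// ler_nat.
Qed.

End UnimodularSpectrum.

(** * Closed subspaces *)

Section Subspaces.
Variables (R : realType) (A : cstarAlgType R).
Implicit Types (x y : A) (B S : set A).

(** Topological closedness, in terms of the real norm. *)
Definition nm_closed B := forall x, (forall e : R, 0 < e -> exists2 y, B y & nm (x - y) < e) -> B x.

Lemma closure_nm_closed B : nm_closed (closure B).
Proof.
move=> x h; apply/closure_nm => e e0; have e2 : 0 < e / 2 by rewrite divr_gt0.
have [y /closure_nm/(_ _ e2)[z Bz yz] xy] := h _ e2.
by exists z => //; rewrite (le_lt_trans (nm_dist y _ _))// [X in _ < X]splitr ltrD.
Qed.

Lemma closed_nm_closed B : closed B -> nm_closed B.
Proof. by move=> cB x h; apply: cB; apply/closure_nm. Qed.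

Lemma closure_sub_nm_closed S B : nm_closed B -> S `<=` B -> closure S `<=` B.
Proof. by move=> cB SB x /closure_nm h; apply: cB => e /h[y /SB]; exists y. Qed.

Lemma nm_closed_preim (f : A -> A) (C : R) B : 0 < C ->
  (forall x y, nm (f x - f y) <= C * nm (x - y)) -> nm_closed B ->
  nm_closed [set x | B (f x)].
Proof.
move=> C0 fC cB x h; apply: cB => e e0; have d0 : 0 < e / C by rewrite divr_gt0.
have [y By xy] := h _ d0; exists (f y) => //.
by rewrite (le_lt_trans (fC _ _))// mulrC -ltr_pdivlMr.
Qed.

Lemma linear_span_sub S B : linear_subspace B -> S `<=` B -> linear_span S `<=` B.
Proof.
move=> [B0 Blin] SB x [n [c [v [Sv ->]]]].
elim: n c v Sv => [|n ih] c v Sv; first by rewrite big_ord0.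
rewrite big_ord_recl; apply: Blin; [exact: SB|exact: ih].
Qed.

Lemma sub_linear_span S : S `<=` linear_span S.
Proof.
move=> x Sx; exists 1%N, (fun=> 1), (fun=> x); split=> //.
by rewrite big_ord1 scale1r.
Qed.

Lemma linear_span_subspace S : linear_subspace (linear_span S).
Proof.
split; first by exists 0%N, (fun=> 0), (fun=> 0); split=> [[]//|]; rewrite big_ord0.
move=> a x y [n [c [v [Sv ->]]]] [m [d [u [Su ->]]]].
exists (n + m)%N, (fun i => match fintype.split i with inl j => a * c j | inr j => d j end),
  (fun i => match fintype.split i with inl j => v j | inr j => u j end); split.
  by move=> i; case: (fintype.split i).
rewrite big_split_ord scaler_sumr /=; congr (_ + _); apply: eq_bigr => i _.
  by rewrite (unsplitK (inl i : 'I_n + 'I_m)) scalerA.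
by rewrite (unsplitK (inr i : 'I_n + 'I_m)).
Qed.

Lemma closure_subspace B : linear_subspace B -> linear_subspace (closure B).
Proof.
move=> [B0 Blin]; split; first exact: subset_closure.
move=> c x y /closure_nm hx /closure_nm hy; apply/closure_nm => e e0.
have c0 : 0 < nm c + 1 by rewrite nm1_gt0.
have d0 : 0 < e / (2 * (nm c + 1)) by rewrite divr_gt0// mulr_gt0.
have e2 : 0 < e / 2 by rewrite divr_gt0.
have [x' Bx' xx] := hx _ d0; have [y' By' yy] := hy _ e2.
exists (c *: x' + y'); first exact: Blin.
rewrite opprD addrACA -scalerBr (le_lt_trans (nmD _ _))// nmZ.
have : nm c * nm (x - x') <= (nm c + 1) * (e / (2 * (nm c + 1))).
  by apply: ler_pM; rewrite ?nm_ge0 ?lerDl// ltW.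
have -> : (nm c + 1) * (e / (2 * (nm c + 1))) = e / 2 by field; rewrite gt_eqF.
move: yy; lra.
Qed.

End Subspaces.

(** * Eigenoperators, definite elements and the multiplicative core *)

Section Main.
Variables (R : realType) (A : cstarAlgType R) (phi : {linear A -> A}).
Variable (F : set {scalar A}).
Hypotheses (phi_pos : positive_map phi) (phi1 : phi 1 = 1).
Hypothesis phi_orbits : precompact_orbits phi.
Hypothesis F_inv : forall rho : {scalar A}, F rho -> invariant_state phi rho.
Hypothesis F_faithful : faithful_on F (cstar_generated (range phi)).
Implicit Types (x y a b : A).

Local Notation N := (cstar_generated (range phi)).
Local Notation E := (eigen_space phi).

Let nm_it n x : nm (iter n phi x) <= 2 * nm x := nm_iter phi_pos phi1 n x.
Let nm_phi x : nm (phi x) <= 2 * nm x := nm_it 1 x.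
Let two1 : 1 <= 2 :> R. Proof. by rewrite ler1n. Qed.

Lemma N_range x : N (phi x).
Proof. by move=> B [_ sB]; apply: sB; exists x. Qed.

Lemma N_subspace : linear_subspace N.
Proof.
split=> [B [[[B0 _] _ _ _] _]//|c x y Nx Ny B cB].
by have [[[_ Bl] _ _ _] _] := cB; apply: Bl; [exact: Nx|exact: Ny].
Qed.

Lemma N_scale c x : N x -> N (c *: x).
Proof. by move=> Nx; rewrite -[_ *: _]addr0; apply: N_subspace.2 => //; exact: N_subspace.1. Qed.

Lemma N_sub x y : N x -> N y -> N (x - y).
Proof. by move=> Nx Ny; rewrite addrC -scaleN1r; apply: N_subspace.2. Qed.

Lemma N_adj x : N x -> N (adj x).
Proof. by move=> Nx B cB; have [[_ _ Ba _] _] := cB; apply: Ba; exact: Nx. Qed.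

Lemma N_jordan x y : N x -> N y -> N (jordan x y).
Proof.
move=> Nx Ny; apply: N_scale => B cB; have [[[_ Bl] Bm _ _] _] := cB.
by rewrite -[_ * _]scale1r; apply: Bl; apply: Bm; (exact: Nx || exact: Ny).
Qed.

Lemma N_closed : nm_closed N.
Proof.
move=> x h B cB; have [[_ _ _ cl] _] := cB; apply: (closed_nm_closed cl) => e /h[y Ny xy].
by exists y => //; exact: Ny.
Qed.

Lemma definite_closed : nm_closed (definite_set phi).
Proof.
have bound x y : nm (defect phi x y) <= 6 * nm x * nm y.
  rewrite /defect (le_trans (nmB _ _))//.
  have h1 := nm_phi (jordan x (adj y)); have := nm_jordan x (adj y).
  have := nm_jordan (phi x) (adj (phi y)); rewrite !nm_adj.
  have : nm (phi x) * nm (phi y) <= (2 * nm x) * (2 * nm y) by apply: ler_pM; rewrite ?nm_ge0.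
  move: h1; lra.
move=> a h; apply/definite_defect; apply: nm0_eq0; apply/eqP; rewrite eq_le nm_ge0 andbT.
apply/ler_addgt0Pr => e e0; rewrite add0r.
have C0 : 0 < 6 * (2 * nm a + 1).
  by rewrite mulr_gt0// ltr_wpDl// mulr_ge0// nm_ge0.
have d0 : 0 < Num.min 1 (e / (6 * (2 * nm a + 1))) by rewrite lt_min ltr01 divr_gt0.
have [b /definite_defect db] := h _ d0; rewrite lt_min => /andP[ab1 abe].
have -> : defect phi a a = defect phi (a - b) a + defect phi b (a - b).
  have e1 := defectDl phi (a - b) b a; have e2 := defectDr phi b (a - b) b.
  by rewrite subrK in e1 e2; rewrite e1 e2 db addr0.
rewrite (le_trans (nmD _ _))//.
have := bound (a - b) a; have := bound b (a - b).
have : nm b * nm (a - b) <= (nm a + 1) * nm (a - b).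
  rewrite ler_wpM2r ?nm_ge0// -[b](subrK a) (le_trans (nmD _ _))//.
  by rewrite addrC lerD2l nmBC ltW.
by move: abe; rewrite ltr_pdivlMr//; lra.
Qed.

(** The range of phi contains v, so the defect of v is in N, where the invariant
    states are faithful; they annihilate it because the eigenvalue is unimodular. *)
Lemma eigen_definite v : eigenoperators phi v -> N v /\ definite_set phi v.
Proof.
move=> [l /nm1P l1 ev].
have l0 : l != 0 by apply/eqP => l0; move: l1; rewrite l0 nm0 => /eqP; rewrite eq_sym oner_eq0.
have Nv : N v.
  have -> : v = phi (l^-1 *: v) by rewrite linearZ /= ev scalerA mulVf// scale1r.
  exact: N_range.
split=> //; apply/definite_defect; apply: F_faithful.
- by apply: N_sub; [exact: N_range|apply: N_jordan; [|apply: N_adj]; exact: N_range].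
- exact: defect_pos.
- move=> rho /F_inv[_ inv]; rewrite /defect linearB /= inv ev.
  rewrite Defs.adjZ jordanZl jordanZr scalerA -normCK.
  by rewrite (iffRL (nm1P l) l1) expr1n scale1r subrr.
Qed.

(** Induction principle for E. *)
Lemma eigen_ind B : linear_subspace B -> nm_closed B -> eigenoperators phi `<=` B -> E `<=` B.
Proof.
move=> lB cB eB; apply: closure_sub_nm_closed => //; exact: linear_span_sub.
Qed.

Lemma eigen_sub : eigenoperators phi `<=` E.
Proof. by move=> v ev; apply: subset_closure; exact: sub_linear_span. Qed.

Lemma E_subspace : linear_subspace E.
Proof. by apply: closure_subspace; exact: linear_span_subspace. Qed.

Lemma E_closed : nm_closed E. Proof. exact: closure_nm_closed. Qed.

Lemma E_sub x y : E x -> E y -> E (x - y).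
Proof. by move=> Ex Ey; rewrite addrC -scaleN1r; apply: E_subspace.2. Qed.

Lemma preim_subspace (f : A -> A) : (forall (c : R[i]) x y, f (c *: x + y) = c *: f x + f y) ->
  linear_subspace [set x | E (f x)].
Proof.
move=> fl; split=> /= [|c x y Ex Ey].
  have f0 : f 0 = 0 by have := fl (-1) 0 0; rewrite scaler0 addr0 scaleN1r addNr.
  by rewrite f0; exact: E_subspace.1.
by rewrite fl; exact: E_subspace.2.
Qed.

Lemma E_N x : E x -> N x.
Proof. by apply: eigen_ind; [exact: N_subspace|exact: N_closed|move=> v /eigen_definite[]]. Qed.

Lemma E_definite x : E x -> definite_set phi x.
Proof.
apply: eigen_ind; last by move=> v /eigen_definite[].
  split; last by move=> c a b; exact: definite_linear.
  by apply/definite_defect; have := defectZl phi 0 0 0; rewrite !scale0r.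
exact: definite_closed.
Qed.

Lemma E_phi x : E x -> E (phi x).
Proof.
apply: (@eigen_ind [set x | E (phi x)]).
- by apply: preim_subspace => c a b; rewrite linearP.
- apply: (@nm_closed_preim _ _ _ 2) => //; last exact: E_closed.
  by move=> a b; rewrite -linearB.
- move=> v /= ev; have [l l1 e] := ev; rewrite e -[_ *: _]addr0.
  by apply: E_subspace.2; [exact: eigen_sub|exact: E_subspace.1].
Qed.

Lemma E_iter n x : E x -> E (iter n phi x).
Proof. by move=> Ex; elim: n => //= n; exact: E_phi. Qed.

Lemma E_adj x : E x -> E (adj x).
Proof.
apply: (@eigen_ind [set x | E (adj x)]).
- split=> /= [|c a b Ea Eb]; first by rewrite adj0; exact: E_subspace.1.
  by rewrite adjD Defs.adjZ; exact: E_subspace.2.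
- apply: (@nm_closed_preim _ _ _ 1) => //; last exact: E_closed.
  by move=> a b; rewrite -adjB nm_adj mul1r.
- move=> v [l /nm1P l1 e]; apply: eigen_sub; exists (Num.conj l).
    by apply/nm1P; rewrite nm_conj.
  by rewrite (phi_adj phi_pos phi1) e Defs.adjZ.
Qed.

Lemma E_jordan x y : E x -> E y -> E (jordan x y).
Proof.
have lip z a b : nm (jordan z a - jordan z b) <= (nm z + 1) * nm (a - b).
  have -> : jordan z a - jordan z b = jordan z (a - b).
    by rewrite -scaleN1r -jordanZr -jordanDr scaleN1r.
  by rewrite (le_trans (nm_jordan _ _))// ler_wpM2r ?nm_ge0// lerDl.
have clo z : nm_closed [set u | E (jordan z u)].
  exact: (nm_closed_preim (nm1_gt0 z) (lip z) E_closed).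
have sub z : linear_subspace [set u | E (jordan z u)].
  by apply: preim_subspace => c a b; rewrite jordanDr jordanZr.
have ee v u : eigenoperators phi v -> E u -> E (jordan v u).
  move=> ev; apply: (@eigen_ind [set u | E (jordan v u)]) => // u' eu /=.
  apply: eigen_sub; have [_ dv] := eigen_definite ev.
  have [l /nm1P l1 e1] := ev; have [k /nm1P k1 e2] := eu.
  exists (l * k); first by apply/nm1P; rewrite nm_mulc l1 k1 mulr1.
  by rewrite (definite_jordan phi_pos phi1)// e1 e2 jordanZl jordanZr scalerA.
move=> Ex Ey; rewrite jordanC; move: x Ex.
apply: (@eigen_ind [set u | E (jordan y u)]) => // v ev /=.
by rewrite jordanC; exact: ee.
Qed.

Lemma definite_iter_jordan n a b : (forall k, definite_set phi (iter k phi a)) ->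
  iter n phi (jordan a b) = jordan (iter n phi a) (iter n phi b).
Proof.
by move=> da; elim: n => //= n ->; rewrite (definite_jordan phi_pos phi1).
Qed.

Lemma invariant_iter rho n x : F rho -> rho (iter n phi x) = rho x.
Proof. by move=> /F_inv[_ inv]; elim: n => //= n ih; rewrite inv. Qed.

(** Elements whose iterates tend to 0 in norm. *)
Definition stable a :=
  forall e : R, 0 < e -> exists n0, forall n, (n0 <= n)%N -> nm (iter n phi a) < e.

(** rho (a o b) = rho (phi^n a o phi^n b) for all n. *)
Lemma stable_orthogonal rho a b : F rho -> stable a ->
  (forall k, definite_set phi (iter k phi b)) -> rho (jordan a b) = 0.
Proof.
move=> Frho sa db; have [st _] := F_inv Frho.
apply: nm0_eq0; apply/eqP; rewrite eq_le nm_ge0 andbT.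
apply/ler_addgt0Pr => e e0; rewrite add0r.
have d0 : 0 < e / (4 * (nm b + 1)) by rewrite divr_gt0// mulr_gt0// nm1_gt0.
have [n0 /(_ _ (leqnn n0)) hn] := sa _ d0.
rewrite jordanC -(invariant_iter n0 _ Frho) definite_iter_jordan//.
rewrite (le_trans (state_bound st _))//.
have := nm_jordan (iter n0 phi b) (iter n0 phi a).
have : nm (iter n0 phi b) * nm (iter n0 phi a) <= (2 * (nm b + 1)) * (e / (4 * (nm b + 1))).
  apply: ler_pM; rewrite ?nm_ge0//; last exact: ltW.
  by rewrite (le_trans (nm_it _ _))// ler_wpM2l// lerDl.
have -> : (2 * (nm b + 1)) * (e / (4 * (nm b + 1))) = e / 2 by field; rewrite gt_eqF// nm1_gt0.
lra.
Qed.

Lemma jordan_faithful a : N a -> (forall rho, F rho -> rho (jordan a (adj a)) = 0) -> a = 0.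
Proof.
move=> Na h; apply: jordan_eq0; apply: F_faithful => //; last exact: pos_jordan.
by apply: N_jordan => //; exact: N_adj.
Qed.

Lemma definite_adj a : definite_set phi a -> definite_set phi (adj a).
Proof.
by rewrite /definite_set /= adjK jordanC => ->; rewrite jordanC (phi_adj phi_pos phi1) adjK.
Qed.

Lemma stable_definite_eq0 a : N a -> stable a ->
  (forall k, definite_set phi (iter k phi a)) -> a = 0.
Proof.
move=> Na sa da; apply: jordan_faithful => // rho Frho; apply: stable_orthogonal => // k.
suff -> : iter k phi (adj a) = adj (iter k phi a) by exact: definite_adj.
by elim: k => //= k ->; rewrite (phi_adj phi_pos phi1).
Qed.

Lemma recurrent_E x : recurrent phi x -> E x.
Proof.
move=> rx; apply: E_closed => e e0; have e2 : 0 < e / 2 by rewrite divr_gt0.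
have [m [y [l [hy le]]]] := recurrent_eigendecomposition two1 nm_it phi_orbits rx e2.
exists (\sum_(i < m) y i); last by rewrite (le_lt_trans le)// ltr_pdivrMr// ltr_pMr// ltr1n.
apply: subset_closure; exists m, (fun=> 1), y; split.
  by move=> i; have [l1 ey] := hy i; exists (l i) => //; apply/nm1P.
by apply: eq_bigr => i _; rewrite scale1r.
Qed.

Lemma decomposition a : exists2 r, E r /\ recurrent phi r & stable (a - r).
Proof.
have [r rr sr] := recurrent_stable_decomposition two1 nm_it phi_orbits a.
by exists r => //; split=> //; exact: recurrent_E.
Qed.

(** The stable part of x is x - r, which lies in E, hence vanishes. *)
Lemma E_recurrent x : E x -> recurrent phi x.
Proof.
move=> Ex; have [r [Er rr] sr] := decomposition x.
have Exr := E_sub Ex Er.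
suff : x - r = 0 by move=> /eqP; rewrite subr_eq0 => /eqP ->.
apply: stable_definite_eq0 => //; first exact: E_N.
by move=> k; apply: E_definite; exact: E_iter.
Qed.

Lemma E_inj x : E x -> phi x = 0 -> x = 0.
Proof.
move=> /E_recurrent rx px; apply: nm0_eq0; apply/eqP; rewrite eq_le nm_ge0 andbT.
by have := recurrent_lower_bound nm_it 1 rx; rewrite /= px nm0 mulr0.
Qed.

(** A cluster point of phi^(g - 1) x along return times g of x is a preimage of x. *)
Lemma E_surj x : E x -> exists2 y, E y & phi y = x.
Proof.
move=> Ex; have rx := E_recurrent Ex.
have /choice[g hg] : forall n : nat, exists g : nat, nm (iter g.+1 phi x - x) < n.+1%:R^-1.
  move=> n; have [|[//|g] _ h] := rx n.+1%:R^-1 _ 1%N; first by rewrite invr_gt0 ltr0n.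
  by exists g.
have [y hy] := orbit_cluster phi_orbits x g.
exists y.
  apply: E_closed => e e0; have [k _ hk] := hy _ e0 0%N.
  by exists (iter (g k) phi x); [exact: E_iter|rewrite nmBC].
apply/eqP; rewrite -subr_eq0; apply/eqP/nm0_eq0/eqP; rewrite eq_le nm_ge0 andbT.
apply/ler_addgt0Pr => e e0; rewrite add0r; have e4 : 0 < e / 4 by rewrite divr_gt0.
have [k kN hk] := hy _ e4 (Num.truncn (e / 4)^-1).
have gk : nm (iter (g k).+1 phi x - x) < e / 4.
  rewrite (lt_le_trans (hg k))// -[e / 4]invrK lef_pV2 ?posrE ?invr_gt0 ?ltr0n//.
  by rewrite ltW// (lt_le_trans (truncnS_gt _))// ler_nat.
have := nm_dist (iter (g k).+1 phi x) (phi y) x.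
have := nm_phi (y - iter (g k) phi x); rewrite linearB /= (nmBC y).
move: gk hk => /=; lra.
Qed.

(** The inclusion from right to left uses only the first two sets of the
    intersection defining the core: its elements lie in the range of phi and all
    their iterates are definite. *)
Lemma E_core : E = mult_core phi.
Proof.
apply/seteqP; split=> [x Ex n _|x Cx].
  have [y Ey <-] : exists2 y, E y & iter n phi y = x.
    elim: n => [|n [y Ey yx]]; first by exists x.
    have [z Ez zy] := E_surj Ey; exists z => //.
    by rewrite iterSr zy.
  exists y => //; split; first exact: E_definite.
  by move=> k; apply: E_definite; exact: E_iter.
have [r [Er _] sr] := decomposition x.
suff : x - r = 0 by move=> /eqP; rewrite subr_eq0 => /eqP ->.
have [x' [_ dx] /= xx] := Cx 0%N I; rewrite {x'}xx in dx.
have [x' _ /= xx] := Cx 1%N I.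
apply: stable_definite_eq0 => //.
  by apply: N_sub; [rewrite -xx; exact: N_range|exact: E_N].
move=> k; rewrite -scaleN1r addrC iter_linear; apply: definite_linear => //.
by apply: E_definite; exact: E_iter.
Qed.

End Main.

Lemma cvg_norm0 (R : realType) (V : normedModType R[i]) (u : nat -> V) :
  (`|u n| @[n --> \oo] --> (0 : R[i]^o)) <->
  (forall e : R, 0 < e -> exists n0, forall n, (n0 <= n)%N -> nm (u n) < e).
Proof.
have e n : nm (`|u n| - 0 : R[i]^o) = nm (u n) by rewrite subr0 /nm normr_id.
split=> [/(@cvg_nm R R[i]^o) h|h].
  by move=> t /h[n0 hn]; exists n0 => n /hn; rewrite e.
by apply/(@cvg_nm R R[i]^o) => t /h[n0 hn]; exists n0 => n /hn; rewrite e.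
Qed.

Theorem theorem11 (R : realType) (A : cstarAlgType R) (phi : {linear A -> A})
    (F : set {scalar A})
    (phi_pos : positive_map phi) (phi_unital : phi 1 = 1)
    (phi_orbits : precompact_orbits phi)
    (F_inv : forall rho : {scalar A}, F rho -> invariant_state phi rho)
    (F_faithful : faithful_on F (cstar_generated (range phi))) :
  [/\ eigen_space phi = mult_core phi /\ jordan_subalgebra (eigen_space phi),
      jordan_automorphism_on (eigen_space phi) phi &
      forall a : A,
        (forall rho : {scalar A}, F rho ->
           forall b : A, mult_core phi b -> rho (jordan a b) = 0) <->
        (`|iter n phi a| @[n --> \oo] --> (0 : R[i]^o))].
Proof.
have EC := E_core phi_pos phi_unital phi_orbits F_inv F_faithful.
have Edef := E_definite phi_pos phi_unital F_inv F_faithful.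
have Eit := E_iter phi_pos phi_unital.
split; first split=> //.
- split; first exact: E_subspace.
    by move=> x; exact: E_adj.
  by move=> x y; exact: (E_jordan phi_pos phi_unital F_inv F_faithful).
- split.
  + split=> [x|x y|x].
    * by apply: E_phi.
    * rewrite !inE => Ex Ey xy; apply/eqP; rewrite -subr_eq0; apply/eqP.
      apply: (E_inj phi_pos phi_unital phi_orbits F_inv F_faithful).
        exact: E_sub.
      by rewrite linearB /= xy subrr.
    * by move=> /(E_surj phi_pos phi_unital phi_orbits F_inv F_faithful)[y Ey <-]; exists y.
  + by move=> c x y _ _; rewrite linearP.
  + by move=> x y Ex _; rewrite (definite_jordan phi_pos phi_unital)//; exact: Edef.
  + by move=> x _; rewrite (phi_adj phi_pos phi_unital).
- move=> a; rewrite cvg_norm0 -EC; split=> [h|sa rho Frho b Eb].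
    have [r [Er _] sr] := decomposition phi_pos phi_unital phi_orbits a.
    suff r0 : r = 0 by move: sr; rewrite r0 subr0.
    apply: (jordan_faithful F_faithful); first exact: (E_N phi_pos phi_unital F_inv F_faithful).
    move=> rho Frho; have Ear := E_adj phi_pos phi_unital Er.
    have := h rho Frho _ Ear; rewrite -{1}[a](subrK r) jordanDl linearD /=.
    rewrite (stable_orthogonal phi_pos phi_unital F_inv Frho sr) ?add0r// => k.
    by apply: Edef; exact: Eit.
  apply: (stable_orthogonal phi_pos phi_unital F_inv) => // k.
  by apply: Edef; exact: Eit.
Qed.
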